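(* Let $U\subseteq R_{a,b}=H^0(\mathcal{O}_{\mathbb{P}^1\times\mathbb{P}^1}(a,b))$ be a basepoint free four-dimensional subspace with basis $\{p_0,p_1,p_2,p_3\}$, where $b\geq 3$, and let $I_U=(p_0,p_1,p_2,p_3)\subseteq R$. Assume that $I_U$ has a minimal first syzygy $Q$ of bidegree $(0,2)$ and no linear syzygy. Let $V\subseteq U$ be the subspace associated to $Q$. (i) If $\dim_k V=2$, then $I_U$ has two syzygies $S_1,S_2$ of bidegree $(a,b-2)$ such that $\langle Q,S_1,S_2\rangle$ determines the first differential $d_1$ of $\mathcal{Z}_{2a-1,b-1}$, that is, $\mathrm{syz}(I_U)_{2a-1,b-1}=\langle Q,S_1,S_2\rangle_{2a-1,b-1}$. (ii) If $\dim_k V=3$, then $I_U$ has one syzygy $S_1$ of bidegree $(a,b-2)$ and two syzygies $S_2,S_3$ of bidegree $(a,b-1)$ such that $\langle Q,S_1,S_2,S_3\rangle$ determines the first differential $d_1$ of $\mathcal{Z}_{2a-1,b-1}$, that is, $\mathrm{syz}(I_U)_{2a-1,b-1}=\langle Q,S_1,S_2,S_3\rangle_{2a-1,b-1}$. Moreover, in both cases $d_1$ has a $2ab\times 2ab$ matrix representation, and its determinant is (up to a nonzero scalar of $k$) a power of the implicit equation $F$ of $X_U$.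
   Context: Let $k$ be an algebraically closed field and $R=k[s,t,u,v]$, bigraded by $\mathrm{bideg}\, s=\mathrm{bideg}\, t=(1,0)$ and $\mathrm{bideg}\, u=\mathrm{bideg}\, v=(0,1)$; $R_{c,d}$ is the bidegree $(c,d)$ component. Here $a\ge 1$. $U$ is basepoint free if $p_0,\dots,p_3$ have no common zero on $\mathbb{P}^1\times\mathbb{P}^1$, equivalently $\sqrt{I_U}=(s,t)\cap(u,v)$. Then $p_0,\dots,p_3$ define a regular map $\phi_U:\mathbb{P}^1\times\mathbb{P}^1\to\mathbb{P}^3$ with image the surface $X_U$. The implicit equation $F\in S=k[T_0,T_1,T_2,T_3]$ is the irreducible homogeneous polynomial, unique up to scalar, defining $X_U$. Syzygies: $\mathrm{syz}(I_U)=\{(c_0,\dots,c_3)\in R^4:\sum c_ip_i=0\}$. A (first) syzygy of bidegree $(c,d)$ is a nonzero element of $\mathrm{syz}(I_U)$ all of whose entries lie in $R_{c,d}$; it is minimal if it is part of a minimal bihomogeneous generating set of $\mathrm{syz}(I_U)$. A linear syzygy is one of bidegree $(1,0)$ or $(0,1)$. $\langle\cdots\rangle$ denotes the $R$-submodule of $R^4$ generated by the listed syzygies, and $M_{c,d}=M\cap (R_{c,d})^4$ for a bigraded submodule $M\subseteq R^4$. Subspace $V$: write the syzygy as $Q=(a_iu^2+b_iuv+c_iv^2)_{i=0,\dots,3}$ with $a_i,b_i,c_i\in k$, and put $f_0=\sum_i a_ip_i$, $f_1=\sum_i b_ip_i$, $f_2=\sum_i c_ip_i$. Then $V=\mathrm{Span}_k\{f_0,f_1,f_2\}\subseteq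 U$. Approximation complex: let $Z_i$ be the module of $i$-cycles of the Koszul complex on $p_0,\dots,p_3$ over $R$; $\mathcal{Z}$ is the complex with terms $\mathcal{Z}_i=S\otimes_k Z_i$ and differentials induced by the Koszul complex on $T_0,\dots,T_3$. In particular $Z_0=R$, $Z_1=\mathrm{syz}(I_U)$. In the strand $\mathcal{Z}_{2a-1,b-1}$ the first differential is the $S$-linear map $d_1: S\otimes_k \mathrm{syz}(I_U)_{2a-1,b-1}\to S\otimes_k R_{2a-1,b-1}$, $(c_0,\dots,c_3)\mapsto \sum_i c_iT_i$. A matrix representation of $d_1$ is its matrix with respect to a $k$-basis of $\mathrm{syz}(I_U)_{2a-1,b-1}$ and a $k$-basis (e.g. the monomials) of $R_{2a-1,b-1}$. *)

(* Defs.v *)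
From HB Require Import structures.
From mathcomp Require Import all_boot all_order all_algebra.
From mathcomp.multinomials Require Import mpoly.

Set Implicit Arguments.
Unset Strict Implicit.
Unset Printing Implicit Defensive.

Import GRing.Theory.
Local Open Scope ring_scope.

(* The variables s, t, u, v of R = k[s,t,u,v] are 'X_0, ..., 'X_3. *)
Definition vs : 'I_4 := @Ordinal 4 0 isT.
Definition vt : 'I_4 := @Ordinal 4 1 isT.
Definition vu : 'I_4 := @Ordinal 4 2 isT.
Definition vv : 'I_4 := @Ordinal 4 3 isT.

Section LinearAlgebra.
Variables (k : fieldType) (L : lmodType k).

Definition kfree n (e : 'I_n -> L) : Prop :=
  forall c : 'I_n -> k, \sum_i c i *: e i = 0 -> forall i, c i = 0.

Definition kspan n (e : 'I_n -> L) (x : L) : Prop :=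
  exists c : 'I_n -> k, x = \sum_i c i *: e i.

Definition is_basis (W : L -> Prop) n (e : 'I_n -> L) : Prop :=
  kfree e /\ (forall x, W x <-> kspan e x).

Definition has_dim (W : L -> Prop) (n : nat) : Prop :=
  exists e : 'I_n -> L, is_basis W e.

End LinearAlgebra.

Section TensorProductSurface.
Variable k : closedFieldType.

(* R = k[s,t,u,v] and S = k[T_0,..,T_3] are both encoded as {mpoly k[4]}. *)
Local Notation R := {mpoly k[4]}.
Local Notation S := {mpoly k[4]}.
Local Notation R4 := {ffun 'I_4 -> R}.

(* Membership in R_{c,d}, which contains 0. *)
Definition bihom (c d : nat) (f : R) : Prop :=
  forall m : 'X_{1..4}, m \in msupp f ->
    (m vs + m vt = c)%N /\ (m vu + m vv = d)%N.

Definition bihom4 (c d : nat) (x : R4) : Prop := forall i, bihom c d (x i).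

(* Homogeneous coordinates of a point ((s:t),(u:v)) of P^1 x P^1. *)
Definition is_P1P1_point (x : 'I_4 -> k) : Prop :=
  (x vs != 0 \/ x vt != 0) /\ (x vu != 0 \/ x vv != 0).

Definition basepoint_free (p : 'I_4 -> R) : Prop :=
  forall x, is_P1P1_point x -> exists i, (p i).@[x] != 0.

Definition in_syz (p : 'I_4 -> R) (x : R4) : Prop := \sum_i x i * p i = 0.

Definition syz_part (p : 'I_4 -> R) (c d : nat) (x : R4) : Prop :=
  in_syz p x /\ bihom4 c d x.

Definition is_syzygy (p : 'I_4 -> R) (c d : nat) (x : R4) : Prop :=
  x != 0 /\ syz_part p c d x.

(* The R-submodule of R^4 generated by a finite list. *)
Definition Rspan (G : seq R4) (x : R4) : Prop :=
  exists c : 'I_(size G) -> R, forall i, x i = \sum_j c j * (G`_j) i.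

Definition Rspan_part (G : seq R4) (c d : nat) (x : R4) : Prop :=
  Rspan G x /\ bihom4 c d x.

(* As syz(I_U) is finitely generated, its minimal generating sets are finite;
   the last clause also forces G to be duplicate-free. *)
Definition min_bihom_gens (p : 'I_4 -> R) (G : seq R4) : Prop :=
  [/\ forall g, g \in G -> exists c d, bihom4 c d g,
      forall x, in_syz p x <-> Rspan G x
    & forall g, g \in G -> ~ (forall x, in_syz p x <-> Rspan (rem g G) x)].

Definition is_min_syzygy (p : 'I_4 -> R) (c d : nat) (x : R4) : Prop :=
  is_syzygy p c d x /\ (exists G, x \in G /\ min_bihom_gens p G).

Definition no_linear_syzygy (p : 'I_4 -> R) : Prop :=
  (forall x, ~ is_syzygy p 1 0 x) /\ (forall x, ~ is_syzygy p 0 1 x).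

(* u^2, uv, v^2 *)
Definition quad_mon (j : 'I_3) : 'X_{1..4} :=
  nth 0%MM [:: U_(vu) + U_(vu); U_(vu) + U_(vv); U_(vv) + U_(vv)]%MM j.

Definition V_gen (p : 'I_4 -> R) (Q : R4) (j : 'I_3) : R :=
  \sum_i (Q i)@_(quad_mon j) *: p i.

Definition V_space (p : 'I_4 -> R) (Q : R4) : R -> Prop := kspan (V_gen p Q).

(* y : homogeneous coordinates of a point of P^3 lying on X_U. *)
Definition on_surface (p : 'I_4 -> R) (y : 'I_4 -> k) : Prop :=
  exists x, is_P1P1_point x /\
    exists2 l : k, l != 0 & forall i, y i = l * (p i).@[x].

Definition irreducible_mpoly (F : S) : Prop :=
  [/\ F != 0, F \isn't a GRing.unit
    & forall G H : S, F = G * H ->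
        G \is a GRing.unit \/ H \is a GRing.unit].

Definition implicit_equation (p : 'I_4 -> R) (F : S) : Prop :=
  [/\ irreducible_mpoly F,
      exists d, F \is d.-homog
    & forall y : 'I_4 -> k, (exists i, y i != 0) ->
        (F.@[y] = 0 <-> on_surface p y)].

(* S (x)_k R is encoded as R[T_0,..,T_3] = {mpoly R[4]}. *)
Definition tens (f : S) (r : R) :=
  map_mpoly (@mpolyC 4 k) f * r%:MP.

(* d_1(1 (x) x); d_1 is its S-linear extension. *)
Definition d1 (x : R4) := \sum_i tens 'X_i (x i).

(* M is the matrix of d_1 : S (x) syz(I_U)_{c,d} -> S (x) R_{c,d} for some
   k-bases g of syz(I_U)_{c,d} (columns) and h of R_{c,d} (rows). *)
Definition is_matrix_of_d1 (p : 'I_4 -> R) (c d : nat) m n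
    (M : 'M[S]_(m, n)) : Prop :=
  exists (g : 'I_n -> R4) (h : 'I_m -> R),
    [/\ is_basis (syz_part p c d) g,
        is_basis (bihom c d) h
      & forall j, d1 (g j) = \sum_i tens (M i j) (h i)].

End TensorProductSurface.

(* Main.v *)
From Stdlib Require Import Classical.
Require Import Defs.
From HB Require Import structures.
From mathcomp Require Import all_boot all_order all_algebra.
From mathcomp.multinomials Require Import mpoly.
From mathcomp Require Import zify ring.

(* Put t = v = 1, so that forms of bidegree (c, d) become polynomials in s, u over k of bounded
   degrees. Three forms f of bidegrees (a, b_i) without common zero on P^1 x P^1 have a Koszul
   complex that is exact in s-degree 3a - 1: over k[u], Bezout in k(u)[s] shows that a syzygy c
   satisfies d c = f x l for some nonzero d in k[u], and as l |-> f x l is injective on every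
   fibre of the projection to the (u:v)-line when l has s-degree < a, the roots of d can be
   divided out; the fibre at infinity bounds the u-degree of l.
   After a linear change of the p_i, the syzygy Q is (q_0, q_1, 0, 0) with q_0, q_1 coprime, or
   (u^2, uv, v^2, 0). In the first case p_0 = q_1 g and p_1 = -q_0 g, and exactness for
   (g, p_2, p_3) gives the generators; in the second p_0 = v x, p_1 = -(u x + v y), p_2 = u y,
   and exactness for (x, y, p_3) does. Both times the generators are free in bidegree
   (2a - 1, b - 1), which makes d_1 square of size 2ab.
   For y outside X_U, eliminating one p_i by means of y leaves three forms of bidegree (a, b)
   without common zero, so exactness makes d_1(y) injective. Hence F vanishes wherever det d_1
   does, and by Study's lemma every prime factor of det d_1 is a multiple of F. *)

Set Implicit Arguments.
Unset Strict Implicit.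
Unset Printing Implicit Defensive.

Import GRing.Theory.
Local Open Scope ring_scope.

(** * Factorial rings *)

(** The s-degree 2a - 1 is the largest in which a relation among three forms of s-degree a has
    multipliers l of s-degree at most a - 1. The kernel of l |-> f x l on a fibre consists of
    multiples of f, so below degree a the multipliers are unique there, and this is what allows
    denominators and excess u-degree to be removed. The same threshold serves twice: it yields the
    generators, and it makes d_1(y) injective, where the u-degree b - 1 leaves no room for a nonzero
    l. The numbers fit because 2a(b - 2) + 2a + 2a when dim V = 2, and 2a(b - 2) + 2a + a + a when
    dim V = 3, both equal 2ab, the dimension of R_{2a-1,b-1}. The determinant is controlled only
    through its zero set, so comparing it with F requires factorization into primes in
    k[T_0, ..., T_3], obtained from Gauss's lemma. The exponent is not computed; it is positive
    because the determinant vanishes at the origin. *)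

Section Divisibility.
Variable A : idomainType.
Implicit Types (x y z p u : A) (s : seq A).

Definition rdvd x y := exists z, y = x * z.

Definition prime_elt p :=
  [/\ p != 0, p \isn't a GRing.unit
    & forall x y, rdvd p (x * y) -> rdvd p x \/ rdvd p y].

(** Asking for prime factors instead of irreducible ones avoids a separate uniqueness statement. *)
Definition factorable x :=
  exists u s, [/\ u \is a GRing.unit, forall p, p \in s -> prime_elt p
                & x = u * \prod_(p <- s) p].

Lemma rdvd_trans x y z : rdvd x y -> rdvd y z -> rdvd x z.
Proof. by case=> a -> [b ->]; exists (a * b); rewrite mulrA. Qed.

Lemma rdvdMl x y : rdvd x (x * y).
Proof. by exists y. Qed.

Lemma rdvdMr x y : rdvd y (x * y).
Proof. by exists x; rewrite mulrC. Qed.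

Lemma factorable_unit u : u \is a GRing.unit -> factorable u.
Proof. by move=> uu; exists u, [::]; rewrite big_nil mulr1. Qed.

Lemma factorable_prime p : prime_elt p -> factorable p.
Proof.
move=> pp; exists 1, [:: p]; rewrite big_seq1 mul1r; split=> // [|q].
  exact: unitr1.
by rewrite inE => /eqP ->.
Qed.

Lemma factorableM x y : factorable x -> factorable y -> factorable (x * y).
Proof.
case=> u [s [uu sp ->]] [v [t [uv tp ->]]]; exists (u * v), (s ++ t).
rewrite unitrM uu uv big_cat /= mulrACA; split=> // p.
by rewrite mem_cat => /orP [/sp|/tp].
Qed.

Lemma prime_assoc p q : prime_elt p -> prime_elt q -> rdvd q p -> rdvd p q.
Proof.
case=> p0 _ pp [_ qu _] [z ez]; case: (pp q z).
- by exists 1; rewrite ez mulr1.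
- by [].
case=> y ey; case/negP: qu; apply/unitrP; exists y.
suff e : q * y = 1 by rewrite mulrC e.
by apply: (mulfI p0); rewrite mulr1 [in RHS]ez ey; ring.
Qed.

End Divisibility.

Section RingIsomorphism.
Variables (A A' : idomainType) (f : A -> A') (g : A' -> A).
Hypotheses (fK : cancel f g) (gK : cancel g f) (g0 : g 0 = 0).
Hypotheses (f1 : f 1 = 1) (fM : {morph f : x y / x * y}).

Let g1 : g 1 = 1. Proof. by rewrite -f1 fK. Qed.
Let gM : {morph g : x y / x * y}.
Proof. by move=> x y; apply: (can_inj fK); rewrite fM !gK. Qed.

Let f_unit x : x \is a GRing.unit -> f x \is a GRing.unit.
Proof.
by case/unitrP=> y [e1 e2]; apply/unitrP; exists (f y); rewrite -!fM e1 e2.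
Qed.

Lemma prime_iso x : prime_elt x -> prime_elt (f x).
Proof.
case=> x0 xu xp; split.
- by apply: contraNneq x0 => e; rewrite -(fK x) e g0.
- apply: contra xu => /unitrP [y [e1 e2]]; apply/unitrP; exists (g y).
  by split; apply: (can_inj fK); rewrite fM gK f1.
move=> y z [w ew]; case: (xp (g y) (g z)).
- by exists (g w); rewrite -gM ew gM fK.
- by case=> v ev; left; exists (f v); rewrite -fM -ev gK.
- by case=> v ev; right; exists (f v); rewrite -fM -ev gK.
Qed.

Lemma factorable_iso x : factorable x -> factorable (f x).
Proof.
case=> u [s [uu sp ->]]; exists (f u), (map f s); split.
- exact: f_unit.
- by move=> _ /mapP [y ys ->]; apply/prime_iso/sp.
- by rewrite fM big_map (big_morph f fM f1).
Qed.

End RingIsomorphism.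

Definition factorial_ring (A : idomainType) :=
  forall x : A, x != 0 -> factorable x.

(** * Gauss's lemma and Bezout identities with denominators *)

Section GaussLemma.
Variable A : idomainType.
Implicit Types (c p e : A) (f g h P : {poly A}).

Lemma rdvd_polyC p f : rdvd p%:P f <-> forall i, rdvd p f`_i.
Proof.
split=> [[z ->] i|]; first by exists z`_i; rewrite coefCM.
elim/poly_ind: f => [|f c IH] hf; first by exists 0; rewrite mulr0.
case: IH => [i|z ->].
  by have := hf i.+1; rewrite coefD coefMX coefC /= addr0.
have [y ->] : rdvd p c by have := hf 0%N; rewrite coefD coefMX coefC /= add0r.
by exists (z * 'X + y%:P); rewrite polyCM; ring.
Qed.

(** Gauss's lemma, by induction on the sum of the sizes: p divides the product of the constant
    terms, hence one of them, and the factor concerned can lose its constant term and then be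
    divided by the variable. *)
Lemma prime_polyC p : prime_elt p -> prime_elt p%:P.
Proof.
case=> p0 pu pp; split; first by rewrite polyC_eq0.
  by rewrite poly_unitE coefC /= negb_and pu orbT.
move=> f g; have [n] := ubnP (size f + size g).
elim: n f g => // n IH; elim/poly_ind => [|f c _].
  by move=> *; left; exists 0; rewrite mulr0.
elim/poly_ind => [|g d _]; first by move=> *; right; exists 0; rewrite mulr0.
move=> hn hd.
have [f0|f0] := eqVneq (f * 'X + c%:P) 0.
  by left; rewrite f0; exists 0; rewrite mulr0.
have [g0|g0] := eqVneq (g * 'X + d%:P) 0.
  by right; rewrite g0; exists 0; rewrite mulr0.
have szf : (size f < size (f * 'X + c%:P)%R)%N.
  rewrite size_MXaddC; case: ifP => // /andP [/eqP f00 /eqP c0].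
  by rewrite f00 c0 mul0r add0r eqxx in f0.
have szg : (size g < size (g * 'X + d%:P)%R)%N.
  rewrite size_MXaddC; case: ifP => // /andP [/eqP f00 /eqP c0].
  by rewrite f00 c0 mul0r add0r eqxx in g0.
have : rdvd p (c * d).
  move/rdvd_polyC: hd => /(_ 0%N).
  by rewrite coef0M !coefD !coefMX !coefC /= !add0r.
case/pp => [[c' ec]|[d' ed]].
- have : rdvd p%:P (f * (g * 'X + d%:P)).
    apply/rdvd_polyC=> i; move/rdvd_polyC: (hd) => /(_ i.+1).
    rewrite mulrDl coefD mulrAC coefMX /= coefCM => -[z ez].
    exists (z - c' * (g * 'X + d%:P)`_i.+1).
    by rewrite mulrBr -ez ec; ring.
  case/IH; [by move: hn szf; lia | | by right].
  by case=> z ->; left; exists (z * 'X + c'%:P); rewrite ec polyCM; ring.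
- have : rdvd p%:P ((f * 'X + c%:P) * g).
    apply/rdvd_polyC=> i; move/rdvd_polyC: (hd) => /(_ i.+1).
    rewrite mulrDr coefD mulrA coefMX /= coefMC => -[z ez].
    exists (z - d' * (f * 'X + c%:P)`_i.+1).
    by rewrite mulrBr -ez ed; ring.
  case/IH; [by move: hn szg; lia | by left |].
  by case=> z ->; right; exists (z * 'X + d'%:P); rewrite ed polyCM; ring.
Qed.

Lemma prime_of_polyC p : prime_elt p%:P -> prime_elt p.
Proof.
case=> p0 pu pp; split; first by rewrite polyC_eq0 in p0.
  by move: pu; rewrite poly_unitE coefC size_polyC /= -polyC_eq0 p0.
move=> x y [z ez]; case: (pp x%:P y%:P); first by exists z%:P; rewrite -!polyCM ez.
  by move/rdvd_polyC=> /(_ 0%N); rewrite coefC; left.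
by move/rdvd_polyC=> /(_ 0%N); rewrite coefC; right.
Qed.

Definition primitive P := forall p, prime_elt p -> ~ rdvd p%:P P.

(** Each prime factor of c stays prime in the polynomial ring and does not divide P, so it divides h
    and can be cancelled. *)
Lemma strip_scalar c P g h : factorable c -> primitive P ->
  c%:P * g = P * h -> rdvd P g.
Proof.
move=> [u [s [uu sp ->]]] prim; elim: s sp h => [_|p s IH sp] h.
  rewrite big_nil mulr1 => e; exists (u^-1%:P * h).
  by rewrite mulrCA -e mulrA -polyCM mulVr // mul1r.
rewrite big_cons => e.
have [pn0 _ pp] : prime_elt p%:P by apply/prime_polyC/sp; rewrite inE eqxx.
case: (pp P h).
- exists ((u * \prod_(j <- s) j)%:P * g); rewrite -e !polyCM; ring.
- by move/prim; case; apply: sp; rewrite inE eqxx.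
case=> h' eh; apply: (IH _ h').
  by move=> q qs; apply: sp; rewrite inE qs orbT.
by apply: (mulfI pn0); rewrite [RHS]mulrCA -eh -e !polyCM; ring.
Qed.

(** Over a domain [gcdp] is a gcd over the fraction field, so both alternatives carry denominators
    e, or c and c'. *)
Lemma bezout_or_common P h : P != 0 ->
  (exists e U V, e != 0 /\ e%:P = U * P + V * h) \/
  (exists (d : {poly A}) c c' q q', [/\ (1 < size d)%N, c != 0, c' != 0,
                           c%:P * P = d * q & c'%:P * h = d * q']).
Proof.
move=> P0; have d0 : gcdp P h != 0 by rewrite gcdp_eq0 (negPf P0).
have [sd|sd] := leqP (size (gcdp P h)) 1.
- left; have [[U V] /Pdiv.Idomain.eqpP [[c1 c2] /= /andP [n1 n2] e]] := Pdiv.Idomain.Bezoutp P h.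
  have /size_poly1P [r r0 er] : size (gcdp P h) == 1%N.
    by rewrite eqn_leq sd size_poly_gt0.
  exists (c2 * r), (c1%:P * U), (c1%:P * V); split; first by rewrite mulf_neq0.
  by rewrite polyCM -er mul_polyC -e -mul_polyC /=; ring.
right; have /Pdiv.Idomain.dvdpP [[c q] /= c0 e] := Pdiv.Idomain.dvdp_gcdl P h.
have /Pdiv.Idomain.dvdpP [[c' q'] /= c0' e'] := Pdiv.Idomain.dvdp_gcdr P h.
exists (gcdp P h), c, c', q, q'; split=> //.
  by rewrite mul_polyC e mulrC.
by rewrite mul_polyC e' mulrC.
Qed.

Lemma size_factor_polyC c f g : c != 0 -> c%:P = f * g -> size f = 1%N.
Proof.
move=> c0 e; have fg0 : f * g != 0 by rewrite -e polyC_eq0.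
have [f0 g0] : f != 0 /\ g != 0 by apply/andP; rewrite -negb_or -mulf_eq0.
move: (congr1 (fun h : {poly A} => size h) e); rewrite size_polyC c0 size_mul //.
by move: f0 g0; rewrite -!size_poly_gt0 /=; lia.
Qed.

Lemma prime_bezout P h : prime_elt P -> (1 < size P)%N -> ~ rdvd P h ->
  exists e U V, e != 0 /\ e%:P = U * P + V * h.
Proof.
move=> [P0 _ pp] sP ndvd; case: (bezout_or_common h P0) => //.
case=> d [c [c' [q [q' [sd c0 c'0 e e']]]]]; exfalso.
have d0 : d != 0 by rewrite -size_poly_gt0 (ltn_trans _ sd).
case: (pp d q); first by rewrite -e; apply: rdvdMr.
- move=> Pd; have : rdvd P (c'%:P * h).
    by rewrite e'; apply: rdvd_trans (rdvdMl _ _).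
  case/pp => // -[z /(size_factor_polyC c'0) e1]; by rewrite e1 in sP.
case=> r er; move: e; rewrite er mulrCA => e.
have e1 : c%:P = d * r by apply: (mulIf P0); rewrite e; ring.
by rewrite (size_factor_polyC c0 e1) in sd.
Qed.

End GaussLemma.

(** * Polynomial rings over factorial rings *)

Section FactorialPoly.
Variable A : idomainType.
Hypothesis Afact : factorial_ring A.
Implicit Types (c p w : A) (P f g h : {poly A}).

Lemma primitive_dvdC c P : P != 0 -> primitive P -> rdvd c%:P P -> c \is a GRing.unit.
Proof.
move=> P0 prim [z ez]; have c0 : c != 0.
  by apply: contraNneq P0 => c0; rewrite ez c0 mul0r.
have [u [[|p s] [uu sp ec]]] := Afact c0.
  by rewrite ec big_nil mulr1.
case: (prim p); first by apply: sp; rewrite inE eqxx.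
by exists ((u * \prod_(q <- s) q)%:P * z); rewrite ez ec big_cons !polyCM; ring.
Qed.

(** Let P divide f g. If P and f are coprime over the fraction field, some nonzero constant a equals
    U P + V f, so P divides a g, and g by [strip_scalar]. Otherwise irreducibility forces the common
    factor to be P up to constants, and P divides f for the same reason. *)
Lemma prime_irreducible P : primitive P -> (1 < size P)%N ->
  (forall q r : {poly A}, P = q * r -> (size q <= 1)%N \/ (size r <= 1)%N) -> prime_elt P.
Proof.
move=> prim sP irr; have P0 : P != 0 by rewrite -size_poly_gt0 (ltn_trans _ sP).
split=> //; first by rewrite poly_unitE; case: eqP sP => // ->.
move=> f g [h e].
case: (bezout_or_common f P0) => [[a [U [V [a0 ea]]]]|]; last first.
  case=> d [c [c' [q [q' [sd c0 c'0 ec ec']]]]]; left.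
  have [u [s [uu sp es]]] := Afact c0.
  (* The primes of c are cancelled one at a time from c P = d q. Each divides d or q; those taken
     from d are collected in r, which leaves a factorization of P itself. *)
  have [d' [q1 [r [r0 [ed eP]]]]] :
      exists (d' q1 : {poly A}) (r : A), r != 0 /\ (d = r%:P * d' /\ P = d' * q1).
    move: ec; rewrite es => {es c0 ec' sd}.
    elim: s sp d q => [_ d q|p s IH sp d q].
      rewrite big_nil mulr1 => e1; exists d, (u^-1%:P * q), 1.
      by rewrite oner_neq0 mul1r mulrCA -e1 mulrA -polyCM mulVr // mul1r.
    rewrite big_cons => e1.
    have [pn0 _ pp] : prime_elt p%:P by apply/prime_polyC/sp; rewrite inE eqxx.
    have sp' : forall q : A, q \in s -> prime_elt q.
      by move=> x xs; apply: sp; rewrite inE xs orbT.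
    case: (pp d q).
    - by exists ((u * \prod_(j <- s) j)%:P * P); rewrite -e1 !polyCM; ring.
    - case=> d1 ed1; case: (IH sp' d1 q).
        by apply: (mulfI pn0); rewrite [RHS]mulrA -ed1 -e1 !polyCM; ring.
      move=> d' [q1 [r [r0 [e2 e3]]]]; exists d', q1, (p * r); split; last first.
        by rewrite ed1 e2 polyCM -mulrA.
      by rewrite mulf_neq0 // -polyC_eq0.
    - case=> q2 eq2; apply: (IH sp' d q2).
      by apply: (mulfI pn0); rewrite [RHS]mulrCA -eq2 -e1 !polyCM; ring.
  have sd' : (1 < size d')%N by move: sd; rewrite ed mul_polyC size_scale.
  case: (irr _ _ eP) => [|sq]; first by rewrite leqNgt sd'.
  have eq1 : q1 = (q1`_0)%:P by apply: size1_polyC.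
  have uq : q1`_0 \is a GRing.unit.
    by apply: (@primitive_dvdC _ P) => //; rewrite -eq1 eP; apply: rdvdMr.
  move: (q1`_0) eq1 uq => a eq1 ua.
  apply: (@strip_scalar _ c' P f (r%:P * a^-1%:P * q')) => //.
    exact: Afact.
  rewrite ec' ed eP eq1.
  rewrite [RHS](_ : _ = d' * (a%:P * a^-1%:P) * r%:P * q'); last by ring.
  by rewrite -polyCM mulrV // mulr1; ring.
have [|n] := classic (rdvd P f); [by left | right].
apply: (@strip_scalar _ a P g (U * g + V * h)) => //; first exact: Afact.
by rewrite ea mulrDl mulrDr -[V * f * g]mulrA e; ring.
Qed.

(** The primes of the content are among those of the leading coefficient, which are tried in turn. A
    prime not dividing P is moved into w, with the invariant that no prime divisor of w divides P.
    When the list is exhausted w is the leading coefficient, so what remains is primitive. *)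
Lemma content_factor P : P != 0 ->
  exists c P', [/\ c != 0, primitive P' & P = c%:P * P'].
Proof.
move=> P0; have l0 : lead_coef P != 0 by rewrite lead_coef_eq0.
have [u [s [uu sp el]]] := Afact l0.
have uP : forall p, prime_elt p -> rdvd p u -> ~ rdvd p%:P P.
  move=> p [_ /negP pu _] [z ez] _; apply: pu.
  by move: uu; rewrite ez unitrM => /andP [].
elim: s P u {l0 uu} uP P0 sp el => [|p s IH] P w wP P0 sp.
  rewrite big_nil mulr1 => el; exists 1, P; rewrite oner_neq0 mul1r; split=> //.
  move=> p pp pP; apply: (wP p) => //; rewrite -el lead_coefE.
  by case: (rdvd_polyC p P) => /(_ pP).
have pp : prime_elt p by apply: sp; rewrite inE eqxx.
have p0 : p != 0 by case: pp.
have sp' : forall q : A, q \in s -> prime_elt q.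
  by move=> x xs; apply: sp; rewrite inE xs orbT.
rewrite big_cons => el; have [[P1 eP]|np] := classic (rdvd p%:P P).
  have P1n : P1 != 0 by apply: contraNneq P0 => z; rewrite eP z mulr0.
  case: (IH P1 w) => //.
  - by move=> q qp qw [z ez]; apply: (wP q) => //; exists (p%:P * z); rewrite eP ez; ring.
  - apply: (mulfI p0); rewrite -[p in LHS]lead_coefC -lead_coefM -eP el; ring.
  move=> c [P' [c0 prim e]]; exists (p * c), P'; rewrite mulf_neq0 //.
  by rewrite polyCM -mulrA -e.
apply: (IH P (w * p)) => //; last by rewrite el mulrA.
move=> q qq; case: (qq) => q0 qu qp; case/qp; first exact: wP.
move/(prime_assoc pp qq) => [z ez] [y ey]; apply: np.
by exists (z%:P * y); rewrite ey ez polyCM; ring.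
Qed.

Lemma factorable_polyC c : c != 0 -> factorable c%:P.
Proof.
move=> /Afact [u [s [uu sp ->]]]; rewrite polyCM; apply: factorableM.
  have u0 : u != 0 by apply: contraTneq uu => ->; rewrite unitr0.
  by apply: factorable_unit; rewrite poly_unitE coefC size_polyC /= uu u0.
elim: s sp => [_|p s IH sp].
  by rewrite big_nil; apply/factorable_unit/unitr1.
rewrite big_cons polyCM; apply: factorableM; last first.
  by apply: IH => q qs; apply: sp; rewrite inE qs orbT.
by apply/factorable_prime/prime_polyC/sp; rewrite inE eqxx.
Qed.

Theorem factorial_poly : factorial_ring {poly A}.
Proof.
move=> P; have [n] := ubnP (size P); elim: n P => // n IH P sP P0.
have [c [P' [c0 prim eP]]] := content_factor P0.
rewrite eP; apply: factorableM; first exact: factorable_polyC.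
have P'0 : P' != 0 by apply: contraNneq P0 => z; rewrite eP z mulr0.
have {}sP : (size P' < n.+1)%N by move: sP; rewrite eP mul_polyC size_scale.
have [sP1|sP1] := leqP (size P') 1.
  rewrite (size1_polyC sP1); apply: factorable_polyC.
  by rewrite -polyC_eq0 -size1_polyC.
have [[q [r [e sq sr]]]|nf] :=
  classic (exists q r : {poly A}, [/\ P' = q * r, (1 < size q)%N & (1 < size r)%N]).
  have q0 : q != 0 by rewrite -size_poly_gt0 (ltn_trans _ sq).
  have r0 : r != 0 by rewrite -size_poly_gt0 (ltn_trans _ sr).
  move: sP; rewrite e size_mul // => sP.
  by apply: factorableM; apply: IH => //; lia.
apply/factorable_prime/prime_irreducible => // q r e.
have [|sq] := leqP (size q) 1; first by left.
by have [|sr] := leqP (size r) 1; [right | case: nf; exists q, r].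
Qed.

End FactorialPoly.

(** * The hypersurface Nullstellensatz *)

Section LastVariable.
Variables (k : fieldType) (n : nat).

Lemma mpoly_rmorph_ext m (T : comNzRingType)
    (f g : {rmorphism {mpoly k[m]} -> T}) :
  (forall c, f c%:MP = g c%:MP) -> (forall i, f 'X_i = g 'X_i) -> f =1 g.
Proof.
move=> hC hX p; rewrite (mpolyE p) !rmorph_sum; apply: eq_bigr => mm _.
rewrite -mul_mpolyC !rmorphM /= hC; congr (_ * _).
rewrite mpolyXE_id !rmorph_prod; apply: eq_bigr => i _.
by rewrite !rmorphXn /= hX.
Qed.

Definition last_var (i : 'I_n.+1) : {poly {mpoly k[n]}} :=
  if unlift ord_max i is Some j then ('X_j)%:P else 'X.

Definition to_poly : {mpoly k[n.+1]} -> {poly {mpoly k[n]}} :=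
  mmap (polyC \o @mpolyC n k) last_var.

HB.instance Definition _ := GRing.RMorphism.on to_poly.

Definition of_poly : {poly {mpoly k[n]}} -> {mpoly k[n.+1]} :=
  horner_eval 'X_ord_max \o map_poly (@mwiden n k).

HB.instance Definition _ := GRing.RMorphism.on of_poly.

Lemma of_polyC p : of_poly p%:P = mwiden p.
Proof. by rewrite /of_poly /horner_eval /= map_polyC hornerC. Qed.

Lemma of_polyX : of_poly 'X = 'X_ord_max.
Proof. by rewrite /of_poly /horner_eval /= map_polyX hornerX. Qed.

Lemma to_polyC c : to_poly c%:MP = (c%:MP)%:P.
Proof. by rewrite /to_poly mmapC. Qed.

Lemma to_polyX i : to_poly 'X_i = last_var i.
Proof. by rewrite /to_poly mmapX mmap1U. Qed.

Lemma widen_lift (i : 'I_n) : widen_ord (leqnSn n) i = lift ord_max i.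
Proof. by apply: val_inj; rewrite /= /bump leqNgt ltn_ord. Qed.

Lemma to_poly_mwiden p : to_poly (mwiden p) = p%:P.
Proof.
move: p; apply: (@mpoly_rmorph_ext n _ (to_poly \o @mwiden n k) (@polyC _)) => [c|i] /=.
  by rewrite mwidenC to_polyC.
by rewrite mwidenX mnmwiden1 to_polyX /last_var widen_lift liftK.
Qed.

Lemma of_polyK : cancel of_poly to_poly.
Proof.
elim/poly_ind => [|q c IH]; first by rewrite !rmorph0.
rewrite !rmorphD !rmorphM /= IH of_polyX of_polyC to_polyX to_poly_mwiden.
by rewrite /last_var unlift_none.
Qed.

Lemma to_polyK : cancel to_poly of_poly.
Proof.
move=> p; apply: (@mpoly_rmorph_ext n.+1 _ (of_poly \o to_poly) idfun) => [c|i] /=.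
  by rewrite to_polyC of_polyC mwidenC.
rewrite to_polyX /last_var; case: unliftP => [j ->|->]; last exact: of_polyX.
by rewrite of_polyC mwidenX mnmwiden1 widen_lift.
Qed.

Definition snoc_pt (x : 'I_n -> k) (t : k) (i : 'I_n.+1) : k :=
  if unlift ord_max i is Some j then x j else t.

Lemma meval_snoc x t p :
  p.@[snoc_pt x t] = (map_poly (meval x) (to_poly p)).[t].
Proof.
move: p; apply: (@mpoly_rmorph_ext n.+1 _ (meval (snoc_pt x t))
  (horner_eval t \o map_poly (meval x) \o to_poly)) => [c|i] /=.
  by rewrite to_polyC map_polyC /= /horner_eval hornerC !mevalC.
rewrite to_polyX mevalXU /snoc_pt /last_var /horner_eval.
by case: unlift => [j|]; rewrite ?map_polyC ?map_polyX ?hornerC ?hornerX //= mevalXU.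
Qed.

End LastVariable.

Section MpolyFactorial.
Variable k : fieldType.

Lemma mpoly0_const (p : {mpoly k[0]}) : p = (p@_0)%:MP.
Proof.
apply/mpolyP=> m; rewrite mcoeffC (_ : m = 0%MM) ?eqxx ?mulr1 //.
by apply/mnmP; case.
Qed.

Lemma mpolyC_unit n (c : k) : (c%:MP_[n] \is a GRing.unit) = (c != 0).
Proof.
apply/idP/idP => [|c0]; first by apply: contraTneq => ->; rewrite mpolyC0 unitr0.
by apply/unitrP; exists c^-1%:MP; rewrite -!mpolyCM mulVf ?mulfV.
Qed.

Lemma factorial_mpoly n : factorial_ring {mpoly k[n]}.
Proof.
elim: n => [|n IH] p p0.
  apply: factorable_unit; rewrite (mpoly0_const p) mpolyC_unit.
  by apply: contraNneq p0 => e; rewrite (mpoly0_const p) e.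
have q0 : to_poly p != 0.
  by apply: contraNneq p0 => e; rewrite -(to_polyK p) e -(rmorph0 (@to_poly k n)) to_polyK.
have := factorial_poly IH q0.
move/(factorable_iso (@of_polyK k n) (@to_polyK k n) (rmorph0 _) (rmorph1 _) (rmorphM _)).
by rewrite to_polyK.
Qed.

Lemma prime_to_poly n (p : {mpoly k[n.+1]}) : prime_elt p -> prime_elt (to_poly p).
Proof.
exact: (prime_iso (@to_polyK k n) (@of_polyK k n) (rmorph0 _) (rmorph1 _) (rmorphM _)).
Qed.

End MpolyFactorial.

(** * Study's lemma *)

Section Study.
Variable k : closedFieldType.

Lemma mpoly_nonroot n (p : {mpoly k[n]}) : p != 0 -> exists x, p.@[x] != 0.
Proof.
elim: n p => [|n IH] p p0.
  exists (fun=> 0); rewrite (mpoly0_const p) mevalC.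
  by apply: contraNneq p0 => e; rewrite (mpoly0_const p) e.
have q0 : to_poly p != 0.
  by apply: contraNneq p0 => e; rewrite -(to_polyK p) e -(rmorph0 (@to_poly k n)) to_polyK.
have /IH [x xl] : lead_coef (to_poly p) != 0 by rewrite lead_coef_eq0.
have : map_poly (meval x) (to_poly p) != 0.
  by rewrite -size_poly_gt0 size_map_poly_id0 // size_poly_gt0.
by move/closed_nonrootP => [t nt]; exists (snoc_pt x t); rewrite meval_snoc.
Qed.

(** Induction on the number of variables. If P does not involve the last variable, the induction
    hypothesis applies to every coefficient of H. Otherwise, if P did not divide H, there would be e
    = U P + V H with e nonzero and free of the last variable. Over a point where neither e nor the
    leading coefficient of P vanishes, P has a root; H vanishes there too, hence so does e, a
    contradiction. *)
Theorem study_nullstellensatz n (P H : {mpoly k[n]}) : prime_elt P ->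
  (forall x, P.@[x] = 0 -> H.@[x] = 0) -> rdvd P H.
Proof.
elim: n P H => [|n IH] P H Pp PH.
  case: Pp => P0 /negP Pu _; case: Pu; rewrite (mpoly0_const P) mpolyC_unit.
  by apply: contraNneq P0 => e; rewrite (mpoly0_const P) e.
suff [z ez] : rdvd (to_poly P) (to_poly H).
  by exists (of_poly z); rewrite -(to_polyK H) ez rmorphM /= to_polyK.
have pp := prime_to_poly Pp.
have pq x t : (map_poly (meval x) (to_poly P)).[t] = 0 ->
    (map_poly (meval x) (to_poly H)).[t] = 0.
  by have := PH (snoc_pt x t); rewrite (meval_snoc x t P) (meval_snoc x t H).
move: (to_poly P) (to_poly H) pp pq => p h pp pq {P H Pp PH}.
have [sp|sp] := leqP (size p) 1.
  move: pp pq; rewrite (size1_polyC sp); move: (p`_0) => a {sp p} ap aq.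
  apply/rdvd_polyC => i; apply: IH; first exact: prime_of_polyC.
  move=> x ax; suff e : map_poly (meval x) h = 0 by rewrite -coef_map e coef0.
  apply/eqP/negPn/negP=> /closed_nonrootP [t]; rewrite rootE aq ?eqxx //.
  by rewrite map_polyC hornerC /= ax.
apply: NNPP => /(prime_bezout pp sp) [e [U [V [e0 ee]]]].
have lp0 : lead_coef p != 0 by rewrite lead_coef_eq0 -size_poly_gt0 (ltn_trans _ sp).
have [x] := mpoly_nonroot (mulf_neq0 e0 lp0).
rewrite mevalM mulf_eq0 negb_or => /andP [ex lx].
have /closed_rootP [t /rootP rt] : size (map_poly (meval x) p) != 1%N.
  by rewrite size_map_poly_id0 // neq_ltn sp orbT.
move/(congr1 (fun q => (map_poly (meval x) q).[t])): ee.
rewrite map_polyC hornerC /= rmorphD !rmorphM /= hornerD !hornerM rt (pq _ _ rt).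
by rewrite !mulr0 addr0 => /eqP; rewrite (negPf ex).
Qed.

(* Each prime factor of [G] vanishes only where [F] does, hence divides [F]. *)
Theorem irreducible_power n (F G : {mpoly k[n]}) :
  F \isn't a GRing.unit ->
  (forall P H, F = P * H -> P \is a GRing.unit \/ H \is a GRing.unit) ->
  G != 0 -> (forall x, G.@[x] = 0 -> F.@[x] = 0) ->
  exists c e, c != 0 /\ G = c *: F ^+ e.
Proof.
move=> Fu Firr G0 GF; have [u [s [uu sp eG]]] := factorial_mpoly G0.
have unitC (v : {mpoly k[n]}) : v \is a GRing.unit -> exists2 c, c != 0 & v = c%:MP.
  move=> uv; have /andP [/eqP e1 e2] := uv; exists v@_0 => //.
  by move: e2; rewrite unitfE.
have ass P : P \in s -> exists2 c, c != 0 & P = c *: F.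
  move=> Ps; have Pp := sp _ Ps.
  have [H eF] : rdvd P F.
    apply: study_nullstellensatz => // x Px; apply: GF.
    rewrite eG mevalM (big_rem P) //= mevalM Px mul0r mulr0 //.
  case: (Firr _ _ eF) => [PU|HU]; first by case: Pp => _ /negP.
  have [c c0 eH] := unitC _ HU; exists c^-1; first by rewrite invr_eq0.
  by rewrite eF eH mulrC mul_mpolyC scalerA mulVf // scale1r.
have [c c0 eu] := unitC _ uu.
have [d [e [d0 ep]]] : exists d e, d != 0 /\ \prod_(p <- s) p = d *: F ^+ e.
  elim: s ass {sp eG} => [_|P s IHs ass].
    by exists 1, 0%N; rewrite oner_neq0 big_nil scale1r.
  have [|d [e [d0 ed]]] := IHs; first by move=> Q Qs; apply: ass; rewrite inE Qs orbT.
  have [|b b0 eb] := ass P; first by rewrite inE eqxx.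
  exists (b * d), e.+1; rewrite mulf_neq0 // big_cons ed eb.
  by rewrite -scalerAl -scalerAr scalerA exprS.
exists (c * d), e; rewrite mulf_neq0 // -scalerA -mul_mpolyC; split=> //.
by rewrite eG eu; congr (_ * _).
Qed.

End Study.

(** * Koszul relations on P^1 x P^1 *)

Section Cross.
Variable T : comNzRingType.
Implicit Types f l c : T.

Definition is_cross f0 f1 f2 l0 l1 l2 c0 c1 c2 :=
  [/\ c0 = f1 * l2 - f2 * l1, c1 = f2 * l0 - f0 * l2 & c2 = f0 * l1 - f1 * l0].

Lemma is_cross_rot f0 f1 f2 l0 l1 l2 c0 c1 c2 :
  is_cross f0 f1 f2 l0 l1 l2 c0 c1 c2 -> is_cross f1 f2 f0 l1 l2 l0 c1 c2 c0.
Proof. by case. Qed.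

End Cross.

Lemma bezout3 (A : idomainType) (f0 f1 f2 : {poly A}) :
  exists h0 h1 h2 c, c != 0 /\
    h0 * f0 + h1 * f1 + h2 * f2 = c *: gcdp f0 (gcdp f1 f2).
Proof.
have [[U V] /Pdiv.Idomain.eqpP [[c1 c2] /= /andP [n1 n2] e1]] := Pdiv.Idomain.Bezoutp f1 f2.
have [[X Y] /Pdiv.Idomain.eqpP [[c3 c4] /= /andP [n3 n4] e2]] :=
  Pdiv.Idomain.Bezoutp f0 (gcdp f1 f2).
exists (c3%:P * c2%:P * X), (c3%:P * Y * c1%:P * U), (c3%:P * Y * c1%:P * V), (c2 * c4).
rewrite mulf_neq0 //; split=> //.
rewrite -scalerA -e2 -!mul_polyC; rewrite -!mul_polyC in e1.
rewrite !mulrDr [RHS]addrC -!addrA [LHS]addrC; congr (_ + _); last by ring.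
transitivity (c3%:P * Y * (c1%:P * (U * f1 + V * f2))); first by ring.
by rewrite e1; ring.
Qed.

Section Bipoly.
Variable k : closedFieldType.
Implicit Types (F L H : {poly k}) (f l c g : {poly {poly k}}) (w z : k) (a b m n : nat).

(* A form in (s,t),(u,v) is represented by its dehomogenisation at t = v = 1, with outer variable
   s and inner variable u. The bounds are on sizes: bidegree (a, b) is [bibound a.+1 b.+1]. *)
Definition bibound m n f := (size f <= m)%N /\ forall j, (size (f`_j)%R <= n)%N.

(** Restrictions to the fibre over w:1 and, for a form of u-degree n, over 1:0, where only the terms
    in u^n survive. *)
Definition fib w f : {poly k} := map_poly (horner_eval w) f.
Definition fib_inf n f : {poly k} := map_poly (coefp n) f.

(** The F_i stand for forms of degree a on P^1, whose value at infinity is the coefficient of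
    s^a. *)
Definition nocz a F0 F1 F2 :=
  (forall z, ~ [/\ F0.[z] = 0, F1.[z] = 0 & F2.[z] = 0]) /\
  ~ [/\ F0`_a = 0, F1`_a = 0 & F2`_a = 0].

Definition no_common_zero a b0 b1 b2 f0 f1 f2 :=
  (forall w, nocz a (fib w f0) (fib w f1) (fib w f2)) /\
  nocz a (fib_inf b0 f0) (fib_inf b1 f1) (fib_inf b2 f2).

(** Without affine common zeros there is H with H.F a nonzero constant d, and F x L = 0 then gives d
    L = m F with m = H.L. Without a common zero at infinity some F_i has degree at least a, so L_i
    of size at most a forces m = 0. *)
Lemma fiber_cross_inj a F0 F1 F2 L0 L1 L2 : nocz a F0 F1 F2 ->
  (size L0 <= a)%N -> (size L1 <= a)%N -> (size L2 <= a)%N ->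
  is_cross F0 F1 F2 L0 L1 L2 0 0 0 -> [/\ L0 = 0, L1 = 0 & L2 = 0].
Proof.
move=> [aff inf] s0 s1 s2 [e0 e1 e2].
have /size_poly1P [r r0 er] : size (gcdp F0 (gcdp F1 F2)) == 1%N.
  apply/negPn/negP=> /closed_rootP [z]; rewrite !root_gcd => /and3P [/rootP h0 /rootP h1 /rootP h2].
  by case: (aff z).
have [H0 [H1 [H2 [c [c0 e]]]]] := bezout3 F0 F1 F2; move: e.
rewrite er -mul_polyC -polyCM => e; have {r c c0 r0 er e} [d d0 e] :
    exists2 d : k, d != 0 & H0 * F0 + H1 * F1 + H2 * F2 = d%:P.
  by exists (c * r) => //; rewrite mulf_neq0.
pose m := H0 * L0 + H1 * L1 + H2 * L2.
have E0 : d *: L0 = F0 * m.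
  rewrite -mul_polyC -e /m; apply/eqP; rewrite -subr_eq0; apply/eqP.
  transitivity (H2 * (F2 * L0 - F0 * L2) - H1 * (F0 * L1 - F1 * L0)); first by ring.
  by rewrite -e1 -e2; ring.
have E1 : d *: L1 = F1 * m.
  rewrite -mul_polyC -e /m; apply/eqP; rewrite -subr_eq0; apply/eqP.
  transitivity (H0 * (F0 * L1 - F1 * L0) - H2 * (F1 * L2 - F2 * L1)); first by ring.
  by rewrite -e0 -e2; ring.
have E2 : d *: L2 = F2 * m.
  rewrite -mul_polyC -e /m; apply/eqP; rewrite -subr_eq0; apply/eqP.
  transitivity (H1 * (F1 * L2 - F2 * L1) - H0 * (F2 * L0 - F0 * L2)); first by ring.
  by rewrite -e0 -e1; ring.
have fin F L : d *: L = F * m -> (size L <= a)%N -> F`_a != 0 -> m = 0.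
  move=> eL sL Fa; apply/eqP/negPn/negP=> m0.
  have sF : (a < size F)%N.
    by rewrite ltnNge; apply: contra Fa => sF; rewrite nth_default.
  have F0n : F != 0 by rewrite -size_poly_gt0 (leq_ltn_trans _ sF).
  move: sL; rewrite -(size_scale _ d0) eL size_mul // leqNgt.
  by move: m0; rewrite -size_poly_gt0; case: (size m) => // n _; rewrite addnS /= ltn_addr.
have m0 : m = 0.
  case: (eqVneq F0`_a 0) => [f0|]; last exact: fin E0 s0.
  case: (eqVneq F1`_a 0) => [f1|]; last exact: fin E1 s1.
  case: (eqVneq F2`_a 0) => [f2|]; last exact: fin E2 s2.
  by case: inf.
have z L : d *: L = 0 -> L = 0.
  by move/eqP; rewrite scaler_eq0 (negPf d0) /= => /eqP.
by split; apply: z; rewrite ?E0 ?E1 ?E2 m0 mulr0.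
Qed.

(** If the gcd over k(u) were not a unit, it would acquire a root on a fibre that avoids its
    denominators and the zeros of its leading coefficient, and this root would be a common zero. *)
Lemma bezout_bipoly a f0 f1 f2 :
  (forall w, nocz a (fib w f0) (fib w f1) (fib w f2)) ->
  exists (e : {poly k}) h0 h1 h2, e != 0 /\ h0 * f0 + h1 * f1 + h2 * f2 = e%:P.
Proof.
move=> aff; set d := gcdp f0 (gcdp f1 f2).
have [h0 [h1 [h2 [c [c0 e]]]]] := bezout3 f0 f1 f2.
suff /size_poly1P [r r0 er] : size d == 1%N.
  exists (c * r), h0, h1, h2; rewrite mulf_neq0 //; split=> //.
  by rewrite e -/d er -mul_polyC -polyCM.
apply/negPn/negP=> sd.
have /Pdiv.Idomain.dvdpP [[c1 q1] /= n1 e1] : d %| f0 by apply: Pdiv.Idomain.dvdp_gcdl.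
have /Pdiv.Idomain.dvdpP [[c2 q2] /= n2 e2] : d %| f1.
  by apply: Pdiv.Idomain.dvdp_trans (Pdiv.Idomain.dvdp_gcdr _ _) (Pdiv.Idomain.dvdp_gcdl _ _).
have /Pdiv.Idomain.dvdpP [[c3 q3] /= n3 e3] : d %| f2.
  by apply: Pdiv.Idomain.dvdp_trans (Pdiv.Idomain.dvdp_gcdr _ _) (Pdiv.Idomain.dvdp_gcdr _ _).
(* The negated goal includes d = 0, whose leading coefficient must stay out of the product; its
   fibre is 0, of size different from 1, and also has a root. *)
have [w] : exists w, ~~ root (c1 * c2 * c3 * (if d == 0 then 1 else lead_coef d)) w.
  apply/closed_nonrootP; rewrite !mulf_neq0 //.
  by case: ifP => [_|/negbT]; rewrite ?oner_neq0 ?lead_coef_eq0.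
rewrite rootE !hornerM !mulf_eq0 !negb_or => /andP [/andP [/andP [w1 w2] w3] wd].
have /closed_rootP [z /rootP rz] : size (fib w d) != 1%N.
  have [d0|d0] := eqVneq d 0; first by rewrite d0 /fib map_poly0 size_poly0.
  by rewrite /fib size_map_poly_id0 // /horner_eval; rewrite (negPf d0) in wd.
have fin (c' : {poly k}) (q f : {poly {poly k}}) : c' *: f = q * d -> c'.[w] != 0 -> (fib w f).[z] = 0.
  move=> /(congr1 (fun g => (fib w g).[z])); rewrite /fib -mul_polyC !rmorphM /= !hornerM rz.
  rewrite mulr0 map_polyC hornerC /= => /eqP; rewrite mulf_eq0 /horner_eval => /orP [/eqP -> /eqP //|/eqP //].
by case: (aff w) => /(_ z) []; split; [apply: fin e1 _|apply: fin e2 _|apply: fin e3 _].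
Qed.

(** As c.f = 0, the vector l = c x h satisfies f x l = (h.f) c = e c. Pseudo-division of l0 by f0
    subtracts a multiple of f from a multiple of l, which f x l does not notice, and brings l0 down
    to size a. The equations for c1 and c2 then bound f0 l2 and f0 l1, hence l2 and l1, because f0
    has degree exactly a. *)
Lemma koszul_scaled_top a f0 f1 f2 c0 c1 c2 (e : {poly k}) h0 h1 h2 :
  e != 0 -> h0 * f0 + h1 * f1 + h2 * f2 = e%:P ->
  (size f0 <= a.+1)%N -> (size f1 <= a.+1)%N -> (size f2 <= a.+1)%N ->
  (size c1 <= a.*2)%N -> (size c2 <= a.*2)%N ->
  c0 * f0 + c1 * f1 + c2 * f2 = 0 -> f0`_a != 0 ->
  exists (d : {poly k}) (l0 l1 l2 : {poly {poly k}}), [/\ d != 0, (size l0 <= a)%N, (size l1 <= a)%N, (size l2 <= a)%N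
    & is_cross f0 f1 f2 l0 l1 l2 (d%:P * c0) (d%:P * c1) (d%:P * c2)].
Proof.
move=> e0 eh sf0 sf1 sf2 sc1 sc2 syz f0a.
have sf : size f0 = a.+1.
  by apply/eqP; rewrite eqn_leq sf0 ltnNge; apply: contra f0a => sF; rewrite nth_default.
have f0n : f0 != 0 by rewrite -size_poly_gt0 sf.
pose l0 := c1 * h2 - c2 * h1; pose l1 := c2 * h0 - c0 * h2; pose l2 := c0 * h1 - c1 * h0.
have [q [r [d [d0 er sr]]]] : exists (q r : {poly {poly k}}) (d : {poly k}),
    [/\ d != 0, d%:P * l0 = q * f0 + r & (size r <= a)%N].
  exists (l0 %/ f0), (l0 %% f0), (lead_coef f0 ^+ scalp l0 f0); split.
  - by rewrite expf_neq0 // lead_coef_eq0.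
  - by rewrite mul_polyC Pdiv.Idomain.divp_eq.
  - by rewrite -ltnS -sf Pdiv.Idomain.ltn_modpN0.
have E0 : d%:P * e%:P * c0 = f1 * (d%:P * l2 - q * f2) - f2 * (d%:P * l1 - q * f1).
  rewrite -eh; apply/eqP; rewrite -subr_eq0; apply/eqP.
  transitivity (d%:P * h0 * (c0 * f0 + c1 * f1 + c2 * f2)); first by rewrite /l1 /l2; ring.
  by rewrite syz mulr0.
have E1 : d%:P * e%:P * c1 = f2 * r - f0 * (d%:P * l2 - q * f2).
  rewrite (_ : r = d%:P * l0 - q * f0); last by rewrite er; ring.
  rewrite -eh; apply/eqP; rewrite -subr_eq0; apply/eqP.
  transitivity (d%:P * h1 * (c0 * f0 + c1 * f1 + c2 * f2)); first by rewrite /l0 /l2; ring.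
  by rewrite syz mulr0.
have E2 : d%:P * e%:P * c2 = f0 * (d%:P * l1 - q * f1) - f1 * r.
  rewrite (_ : r = d%:P * l0 - q * f0); last by rewrite er; ring.
  rewrite -eh; apply/eqP; rewrite -subr_eq0; apply/eqP.
  transitivity (d%:P * h2 * (c0 * f0 + c1 * f1 + c2 * f2)); first by rewrite /l0 /l1; ring.
  by rewrite syz mulr0.
have bnd l : (size (f0 * l)%R <= a.*2)%N -> (size l <= a)%N.
  have [->|l0'] := eqVneq l 0; first by rewrite size_poly0.
  by rewrite size_mul // sf addSn /= -addnn leq_add2l.
have sde c : (size (d%:P * e%:P * c)%R <= size c)%N.
  by rewrite -polyCM mul_polyC; apply: size_scale_leq.
have sfr f : (size f <= a.+1)%N -> (size (f * r)%R <= a.*2)%N.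
  by move=> hf; apply: leq_trans (size_polyMleq _ _) _; move: hf sr; lia.
exists (d * e), r, (d%:P * l1 - q * f1), (d%:P * l2 - q * f2); split.
- by rewrite mulf_neq0.
- by [].
- apply: bnd; rewrite (_ : f0 * _ = d%:P * e%:P * c2 + f1 * r); last by rewrite E2; ring.
  apply: leq_trans (size_polyD _ _) _; rewrite geq_max sfr // andbT.
  by apply: leq_trans (sde _) _.
- apply: bnd; rewrite (_ : f0 * _ = f2 * r - d%:P * e%:P * c1); last by rewrite E1; ring.
  apply: leq_trans (size_polyD _ _) _; rewrite size_polyN geq_max sfr //.
  by apply: leq_trans (sde _) _.
- by rewrite polyCM; split.
Qed.

Lemma fib_scale_root w (d : {poly k}) f : root d w -> fib w (d%:P * f) = 0.
Proof. by move=> /rootP rd; rewrite /fib rmorphM /= map_polyC /= /horner_eval rd mul0r. Qed.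

Lemma fib0_factor w f : fib w f = 0 -> exists2 g, f = ('X - w%:P)%:P * g & size g = size f.
Proof.
move=> f0; have r j : root f`_j w.
  by apply/rootP; have := coef_map (horner_eval w) f j; rewrite -/(fib w f) f0 coef0 => /esym.
have X0 : 'X - w%:P != 0 by rewrite polyXsubC_eq0.
suff [g eg] : exists g, f = ('X - w%:P)%:P * g.
  by exists g; rewrite // eg mul_polyC size_scale.
exists (map_poly (fun q => q %/ ('X - w%:P)) f); apply/polyP=> j.
rewrite coefCM coef_map_id0 ?div0p // mulrC divpK //.
by rewrite dvdp_XsubCl.
Qed.

Lemma strip_koszul a f0 f1 f2 c0 c1 c2 (d : {poly k}) l0 l1 l2 :
  (forall w, nocz a (fib w f0) (fib w f1) (fib w f2)) -> d != 0 ->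
  (size l0 <= a)%N -> (size l1 <= a)%N -> (size l2 <= a)%N ->
  is_cross f0 f1 f2 l0 l1 l2 (d%:P * c0) (d%:P * c1) (d%:P * c2) ->
  exists m0 m1 m2 : {poly {poly k}}, [/\ (size m0 <= a)%N, (size m1 <= a)%N, (size m2 <= a)%N
    & is_cross f0 f1 f2 m0 m1 m2 c0 c1 c2].
Proof.
move=> aff; have [n] := ubnP (size d); elim: n d l0 l1 l2 => // n IH d l0 l1 l2 sd d0.
move=> s0 s1 s2 [e0 e1 e2].
have [sd1|] := boolP (size d == 1%N).
  have /size_poly1P [r r0 er] := sd1.
  have K c : (r^-1)%:P%:P * (d%:P * c) = c by rewrite er mulrA -!polyCM mulVf ?mul1r.
  exists ((r^-1)%:P *: l0), ((r^-1)%:P *: l1), ((r^-1)%:P *: l2).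
  rewrite !size_scale ?polyC_eq0 ?invr_eq0 //; split=> //; rewrite -!mul_polyC; split.
  - by rewrite -[LHS]K e0; ring.
  - by rewrite -[LHS]K e1; ring.
  - by rewrite -[LHS]K e2; ring.
move/closed_rootP => [w rw].
have fM f g : fib w (f * g) = fib w f * fib w g by rewrite /fib rmorphM.
have fB f g : fib w (f - g) = fib w f - fib w g by rewrite /fib rmorphB.
have sz l : (size l <= a)%N -> (size (fib w l) <= a)%N by apply: leq_trans (size_poly _ _).
have [] := fiber_cross_inj (aff w) (sz _ s0) (sz _ s1) (sz _ s2).
  by split; rewrite -!fM -fB -?e0 -?e1 -?e2 fib_scale_root.
move=> /fib0_factor [m0 em0 sm0] /fib0_factor [m1 em1 sm1] /fib0_factor [m2 em2 sm2].
have [d' ed] : exists d', d = d' * ('X - w%:P) by move/factor_theorem: rw.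
have X0 : 'X - w%:P != 0 by rewrite polyXsubC_eq0.
have XX0 : ('X - w%:P)%:P != 0 :> {poly {poly k}} by rewrite polyC_eq0.
have d'0 : d' != 0 by apply: contraNneq d0 => z; rewrite ed z mul0r.
apply: (IH d' m0 m1 m2) => //; rewrite ?sm0 ?sm1 ?sm2 //.
  by move: sd; rewrite ed size_mul // size_XsubC addn2 /= ltnS.
by split; apply: (mulfI XX0); rewrite mulrA -polyCM [('X - _) * d']mulrC -ed ?e0 ?e1 ?e2 ?em0 ?em1 ?em2; ring.
Qed.

Lemma koszul_affine a f0 f1 f2 c0 c1 c2 :
  (forall w, nocz a (fib w f0) (fib w f1) (fib w f2)) ->
  (size f0 <= a.+1)%N -> (size f1 <= a.+1)%N -> (size f2 <= a.+1)%N ->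
  (size c0 <= a.*2)%N -> (size c1 <= a.*2)%N -> (size c2 <= a.*2)%N ->
  c0 * f0 + c1 * f1 + c2 * f2 = 0 ->
  exists m0 m1 m2 : {poly {poly k}}, [/\ (size m0 <= a)%N, (size m1 <= a)%N, (size m2 <= a)%N
    & is_cross f0 f1 f2 m0 m1 m2 c0 c1 c2].
Proof.
move=> aff sf0 sf1 sf2 sc0 sc1 sc2 syz.
have [e [h0 [h1 [h2 [e0 eh]]]]] := bezout_bipoly aff.
have [z0|n0] := eqVneq f0`_a 0; last first.
  have [d [l0 [l1 [l2 [d0 s0 s1 s2 cr]]]]] :=
    koszul_scaled_top e0 eh sf0 sf1 sf2 sc1 sc2 syz n0.
  exact: strip_koszul cr.
have [z1|n1] := eqVneq f1`_a 0; last first.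
  have [||d [l0 [l1 [l2 [d0 s0 s1 s2 cr]]]]] :=
    @koszul_scaled_top a f1 f2 f0 c1 c2 c0 e h1 h2 h0 e0 _ sf1 sf2 sf0 sc2 sc0 _ n1.
  - by rewrite -eh; ring.
  - by rewrite -syz; ring.
  exact: strip_koszul (is_cross_rot (is_cross_rot cr)).
have [z2|n2] := eqVneq f2`_a 0; last first.
  have [||d [l0 [l1 [l2 [d0 s0 s1 s2 cr]]]]] :=
    @koszul_scaled_top a f2 f0 f1 c2 c0 c1 e h2 h0 h1 e0 _ sf2 sf0 sf1 sc0 sc1 _ n2.
  - by rewrite -eh; ring.
  - by rewrite -syz; ring.
  exact: strip_koszul (is_cross_rot cr).
(* If all three coefficients of s^a were zero, the point s:t = 1:0 would be a common zero on every
   fibre, for instance over u = 0. *)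
by case: (aff 0) => _ []; rewrite /fib !coef_map /= z0 z1 z2 /horner_eval horner0.
Qed.

Lemma coef_top_mul m n F L : (size F <= m.+1)%N -> (size L <= n.+1)%N ->
  (F * L)`_(m + n) = F`_m * L`_n.
Proof.
move=> sF sL; rewrite coefM (bigD1 (Ordinal (leq_addr n m : m < (m + n).+1)%N)) //=.
rewrite addKn big1 ?addr0 // => i; rewrite -val_eqE /= => im.
have [lt|ge] := leqP i m; last by rewrite nth_default ?mul0r // (leq_trans sF).
by rewrite [L`_ _]nth_default ?mulr0 // (leq_trans sL) //; move: im lt (ltn_ord i); lia.
Qed.

Lemma fib_infM m n f l : (forall j, size (f`_j)%R <= m.+1)%N -> (forall j, size (l`_j)%R <= n.+1)%N ->
  fib_inf (m + n) (f * l) = fib_inf m f * fib_inf n l.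
Proof.
move=> sf sl; apply/polyP=> j; rewrite coef_map /= coefM coef_sum coefM.
by apply: eq_bigr => i _; rewrite !coef_map /= coef_top_mul.
Qed.

Lemma fib_inf0 n f : (forall j, size (f`_j)%R <= n)%N -> fib_inf n f = 0.
Proof.
by move=> sf; apply/polyP=> j; rewrite coef_map /= coef0 nth_default.
Qed.

(* One step of the descent on the inner degree of [l], which compares top coefficients. *)
Lemma koszul_descent N B a b0 b1 b2 f0 f1 f2 c0 c1 c2 l0 l1 l2 :
  nocz a (fib_inf b0 f0) (fib_inf b1 f1) (fib_inf b2 f2) ->
  (b0 + b1 + b2 = B)%N ->
  bibound a.+1 b0.+1 f0 -> bibound a.+1 b1.+1 f1 -> bibound a.+1 b2.+1 f2 ->
  is_cross f0 f1 f2 l0 l1 l2 c0 c1 c2 ->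
  (forall j, size (c0`_j)%R + b0 <= N + B)%N ->
  (forall j, size (c1`_j)%R + b1 <= N + B)%N ->
  (forall j, size (c2`_j)%R + b2 <= N + B)%N ->
  bibound a (N + b0).+1 l0 -> bibound a (N + b1).+1 l1 -> bibound a (N + b2).+1 l2 ->
  [/\ bibound a (N + b0) l0, bibound a (N + b1) l1 & bibound a (N + b2) l2].
Proof.
move=> inf eB [_ sf0] [_ sf1] [_ sf2] [e0 e1 e2] sc0 sc1 sc2 [s0 t0] [s1 t1] [s2 t2].
have sz n l : (size l <= a)%N -> (size (fib_inf n l) <= a)%N by apply: leq_trans (size_poly _ _).
have fB n f g : fib_inf n (f - g) = fib_inf n f - fib_inf n g by rewrite /fib_inf raddfB.
have [] := fiber_cross_inj inf (sz (N + b0)%N _ s0) (sz (N + b1)%N _ s1) (sz (N + b2)%N _ s2).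
  split.
  - rewrite -!fib_infM // (_ : b2 + (N + b1) = b1 + (N + b2))%N; last by lia.
    by rewrite -fB -e0 fib_inf0 // => j; have := sc0 j; lia.
  - rewrite -!fib_infM // (_ : b2 + (N + b0) = b0 + (N + b2))%N; last by lia.
    by rewrite -fB -e1 fib_inf0 // => j; have := sc1 j; lia.
  - rewrite -!fib_infM // (_ : b1 + (N + b0) = b0 + (N + b1))%N; last by lia.
    by rewrite -fB -e2 fib_inf0 // => j; have := sc2 j; lia.
have red n l : (size l <= a)%N -> (forall j, size (l`_j)%R <= n.+1)%N -> fib_inf n l = 0 -> bibound a n l.
  move=> sl tl z; split=> // j.
  have := tl j; rewrite leq_eqVlt => /orP [/eqP e|]; last by rewrite ltnS.
  have := coef_map (coefp n) l j; rewrite -/(fib_inf n l) z coef0 /= => /esym.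
  rewrite -[n]/(n.+1.-1) -e -lead_coefE => /eqP; rewrite lead_coef_eq0 => /eqP h.
  by rewrite h size_poly0 in e.
by move=> z0 z1 z2; split; apply: red.
Qed.

(** All products c_i f_i have u-degree less than D. As c_i is built from f_j l_k and f_k l_j, the
    expected size of l_k is D - b_i - b_j, written here as D + b_k minus the sum of the b's. A bound
    truncated to 0 means l_k = 0. *)
Theorem koszul_exact D a b0 b1 b2 f0 f1 f2 c0 c1 c2 :
  no_common_zero a b0 b1 b2 f0 f1 f2 ->
  bibound a.+1 b0.+1 f0 -> bibound a.+1 b1.+1 f1 -> bibound a.+1 b2.+1 f2 ->
  (size c0 <= a.*2)%N -> (size c1 <= a.*2)%N -> (size c2 <= a.*2)%N ->
  (forall j, size (c0`_j)%R + b0 <= D)%N ->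
  (forall j, size (c1`_j)%R + b1 <= D)%N ->
  (forall j, size (c2`_j)%R + b2 <= D)%N ->
  c0 * f0 + c1 * f1 + c2 * f2 = 0 ->
  exists l0 l1 l2, [/\ is_cross f0 f1 f2 l0 l1 l2 c0 c1 c2,
    bibound a (D + b0 - (b0 + b1 + b2)) l0, bibound a (D + b1 - (b0 + b1 + b2)) l1
    & bibound a (D + b2 - (b0 + b1 + b2)) l2].
Proof.
move=> [aff inf] bf0 bf1 bf2 s0 s1 s2 t0 t1 t2 syz.
have [l0 [l1 [l2 [sl0 sl1 sl2 [e0 e1 e2]]]]] :=
  koszul_affine aff (proj1 bf0) (proj1 bf1) (proj1 bf2) s0 s1 s2 syz.
exists l0, l1, l2; set B := (b0 + b1 + b2)%N.
have XnN0 : 'X^B != 0 :> {poly k} by rewrite -size_poly_gt0 size_polyXn.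
(* Multiplication by u^B keeps the degree bounds of the descent nonnegative, so truncation occurs
   only once, when u^B is removed at the end. *)
pose up g : {poly {poly k}} := ('X^B)%:P * g.
have size_up g j : (size ((up g)`_j)%R <= size (g`_j)%R + B)%N.
  have [z|z] := eqVneq g`_j 0; first by rewrite coefCM z mulr0 size_poly0.
  by rewrite coefCM size_mul // size_polyXn addSn /= addnC.
have up_bound n g : bibound a n (up g) -> bibound a (n - B) g.
  move=> [sg tg]; split; first by move: sg; rewrite /up mul_polyC size_scale.
  move=> j; have := tg j; have [->|z] := eqVneq g`_j 0; first by rewrite size_poly0.
  by rewrite coefCM size_mul // size_polyXn addSn /= => h; rewrite -(addKn B (size _)); apply: leq_sub2r.
have cr : is_cross f0 f1 f2 (up l0) (up l1) (up l2) (up c0) (up c1) (up c2).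
  by split; rewrite /up ?e0 ?e1 ?e2; ring.
have [M hM] : exists M, forall l, l \in [:: l0; l1; l2] -> forall j, (size ((up l)`_j)%R <= M)%N.
  exists (\max_(l <- [:: l0; l1; l2]) \max_(j < size (up l)) size ((up l)`_j)%R)%N => l ll j.
  have [sj|sj] := ltnP j (size (up l)); last by rewrite nth_default // size_poly0.
  apply: leq_trans (leq_bigmax_seq _ ll isT).
  exact: (@leq_bigmax _ (fun j : 'I__ => size ((up l)`_j)%R) (Ordinal sj)).
(* M is a crude bound for all u-sizes; each of M descent steps lowers the three bounds by one. *)
suff : forall N, (N <= M)%N -> let N' := (D + (M - N))%N in
    [/\ bibound a (N' + b0) (up l0), bibound a (N' + b1) (up l1) & bibound a (N' + b2) (up l2)].
  by move=> /(_ M (leqnn _)) /=; rewrite subnn addn0 => -[*]; split=> //; apply: up_bound.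
have su l : (size l <= a)%N -> (size (up l) <= a)%N by rewrite /up mul_polyC size_scale.
elim=> [_|N IH NM] /=.
  by rewrite subn0; split; split; rewrite ?su // => j; apply: leq_trans (hM _ _ _) _;
    rewrite ?inE ?eqxx ?orbT // -addnA addnCA leq_addr.
have {IH} /= := IH (ltnW NM); rewrite (_ : M - N = (M - N.+1).+1)%N; last by lia.
rewrite addnS !addSn => -[u0 u1 u2].
have bnd c b : (forall j, size (c`_j)%R + b <= D)%N ->
    forall j, (size ((up c)`_j)%R + b <= D + (M - N.+1) + B)%N.
  move=> h j; apply: leq_trans (leq_add (size_up c j) (leqnn b)) _.
  by move: (h j); set x := size _ => hx; lia.
by apply: (koszul_descent inf _ bf0 bf1 bf2 cr) => //; apply: bnd.
Qed.

End Bipoly.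

(** * Syzygies when dim V = 2 *)

Definition o0 : 'I_4 := @Ordinal 4 0 isT.
Definition o1 : 'I_4 := @Ordinal 4 1 isT.
Definition o2 : 'I_4 := @Ordinal 4 2 isT.
Definition o3 : 'I_4 := @Ordinal 4 3 isT.

Lemma sum4 (V : nmodType) (F : 'I_4 -> V) : \sum_i F i = F o0 + F o1 + F o2 + F o3.
Proof.
rewrite !big_ord_recl big_ord0 addr0 !addrA.
by congr (F _ + F _ + F _ + F _); apply: val_inj.
Qed.

Lemma prod4 (T : pzSemiRingType) (F : 'I_4 -> T) : \prod_i F i = F o0 * F o1 * F o2 * F o3.
Proof.
rewrite !big_ord_recl big_ord0 mulr1 !mulrA.
by congr (F _ * F _ * F _ * F _); apply: val_inj.
Qed.

Lemma forall4 (Pr : 'I_4 -> Prop) : Pr o0 -> Pr o1 -> Pr o2 -> Pr o3 -> forall i, Pr i.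
Proof.
move=> h0 h1 h2 h3 i; case: i => -[|[|[|[|m]]]] lt //.
- by rewrite (_ : Ordinal lt = o0) //; apply: val_inj.
- by rewrite (_ : Ordinal lt = o1) //; apply: val_inj.
- by rewrite (_ : Ordinal lt = o2) //; apply: val_inj.
- by rewrite (_ : Ordinal lt = o3) //; apply: val_inj.
Qed.

Definition vec4 (T : Type) (x0 x1 x2 x3 : T) (i : 'I_4) : T := nth x0 [:: x0; x1; x2; x3] i.

(** * Degree bounds and evaluation at points of P^1 x P^1 *)

Section Bounds.
Variable k : closedFieldType.
Implicit Types (q r : {poly k}) (f g : {poly {poly k}}).

Lemma bibound_le m n m' n' f : (m <= m')%N -> (n <= n')%N -> bibound m n f -> bibound m' n' f.
Proof.
move=> mm nn [s t]; split; first exact: leq_trans mm.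
by move=> j; apply: leq_trans nn.
Qed.

Lemma bibound0 m n : bibound m n (0 : {poly {poly k}}).
Proof. by split=> [|j]; rewrite ?coef0 size_poly0. Qed.

Lemma bibound0_eq m f : bibound m 0 f -> f = 0.
Proof.
case=> _ t; apply/polyP=> j; rewrite coef0; apply/eqP.
by rewrite -size_poly_eq0 -leqn0.
Qed.

Lemma biboundD m n f g : bibound m n f -> bibound m n g -> bibound m n (f + g).
Proof.
move=> [s t] [s' t']; split=> [|j]; rewrite ?coefD.
  by apply: leq_trans (size_polyD _ _) _; rewrite geq_max s s'.
by apply: leq_trans (size_polyD _ _) _; rewrite geq_max t t'.
Qed.

Lemma biboundN m n f : bibound m n f -> bibound m n (- f).
Proof. by move=> [s t]; split=> [|j]; rewrite ?coefN size_polyN. Qed.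

Lemma biboundB m n f g : bibound m n f -> bibound m n g -> bibound m n (f - g).
Proof. by move=> hf hg; apply: biboundD => //; apply: biboundN. Qed.

Lemma biboundM m n m' n' f g : bibound m n f -> bibound m' n' g ->
  bibound (m + m').-1 (n + n').-1 (f * g).
Proof.
move=> [s t] [s' t']; split=> [|j].
  by apply: leq_trans (size_polyMleq _ _) _; lia.
rewrite coefM; apply: (big_ind (fun q : {poly k} => size q <= (n + n').-1)%N).
- by rewrite size_poly0.
- by move=> q r hq hr; apply: leq_trans (size_polyD _ _) _; rewrite geq_max hq hr.
- move=> i _; apply: leq_trans (size_polyMleq _ _) _.
  by have := t i; have := t' (j - i)%N; lia.
Qed.

Lemma biboundC n q : (size q <= n)%N -> bibound 1 n q%:P.
Proof.
move=> s; split; first exact: size_polyC_leq1.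
by move=> j; rewrite coefC; case: eqP; rewrite ?size_poly0.
Qed.

Lemma biboundCM m n n' q f : (size q <= n')%N -> bibound m n f ->
  bibound m (n' + n).-1 (q%:P * f).
Proof.
move=> sq hf; have := biboundM (biboundC sq) hf.
by rewrite add1n.
Qed.

Lemma bibound_div m n d q f : size q = d.+1 -> bibound m (n + d) (q%:P * f) -> bibound m n f.
Proof.
move=> sq [s t]; have q0 : q != 0 by rewrite -size_poly_gt0 sq.
split; first by move: s; rewrite mul_polyC size_scale.
move=> j; have [->|fj] := eqVneq f`_j 0; first by rewrite size_poly0.
by have := t j; rewrite coefCM size_mul // sq addSn /= addnC leq_add2r.
Qed.

Lemma bibound_map m n n' (h : {poly k} -> {poly k}) f : h 0 = 0 ->
  (forall q, (size q <= n)%N -> (size (h q) <= n')%N) ->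
  bibound m n f -> bibound m n' (map_poly h f).
Proof.
move=> h0 hs [s t]; split; first by apply: leq_trans (size_poly _ _) s.
by move=> j; rewrite coef_map_id0 //; apply: hs.
Qed.

(** In each factor [Some z] is the point z:1 and [None] is 1:0. Thus [ev a b] evaluates a form of
    bidegree (a, b) through its dehomogenisation. *)
Definition pt := (option k * option k)%type.

Definition ev a b (x : pt) f : k :=
  let F := if x.2 is Some w then fib w f else fib_inf b f in
  if x.1 is Some z then F.[z] else F`_a.

Lemma no_common_zero_ev a b0 b1 b2 f0 f1 f2 :
  (forall x, ~ [/\ ev a b0 x f0 = 0, ev a b1 x f1 = 0 & ev a b2 x f2 = 0]) ->
  no_common_zero a b0 b1 b2 f0 f1 f2.
Proof.
move=> h; split=> [w|]; split.
- by move=> z; apply: (h (Some z, Some w)).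
- by apply: (h (None, Some w)).
- by move=> z; apply: (h (Some z, None)).
- by apply: (h (None, None)).
Qed.

Lemma evD a b x f g : ev a b x (f + g) = ev a b x f + ev a b x g.
Proof. by case: x => -[z|] [w|]; rewrite /ev /= /fib /fib_inf raddfD ?hornerD ?coefD. Qed.

Lemma evN a b x f : ev a b x (- f) = - ev a b x f.
Proof. by case: x => -[z|] [w|]; rewrite /ev /= /fib /fib_inf raddfN ?hornerN ?coefN. Qed.

Lemma evM a b a' b' x f g : bibound a.+1 b.+1 f -> bibound a'.+1 b'.+1 g ->
  ev (a + a') (b + b') x (f * g) = ev a b x f * ev a' b' x g.
Proof.
move=> [s t] [s' t'].
have sz (h : {poly k} -> k) n (p : {poly {poly k}}) : (size p <= n)%N -> (size (map_poly h p) <= n)%N.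
  by apply: leq_trans (size_poly _ _).
case: x => -[z|] [w|]; rewrite /ev /=.
- by rewrite /fib rmorphM hornerM.
- by rewrite fib_infM // hornerM.
- by rewrite /fib rmorphM /= coef_top_mul //; apply: sz.
- by rewrite fib_infM // coef_top_mul //; apply: sz.
Qed.

End Bounds.

Section RankTwo.
Variables (k : closedFieldType) (a n : nat).
Variables (P : 'I_4 -> {poly {poly k}}) (q0 q1 : {poly k}).
Hypothesis Pb : forall i, bibound a.+1 n.+4 (P i).
Hypothesis Pbpf : forall x, ~ (forall i, ev a n.+3 x (P i) = 0).
Hypothesis sq0 : (size q0 <= 3)%N.
Hypothesis sq1 : (size q1 <= 3)%N.
Hypothesis q_neq0 : ~ (q0 = 0 /\ q1 = 0).
Hypothesis Qsyz : q0%:P * P o0 + q1%:P * P o1 = 0.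
Hypothesis P0_neq0 : P o0 != 0.
Hypothesis nolin : forall r0 r1 : {poly k}, (size r0 <= 2)%N -> (size r1 <= 2)%N ->
  r0%:P * P o0 + r1%:P * P o1 = 0 -> r0 = 0 /\ r1 = 0.

(** Otherwise the quadratic forms would share the factor v, and dividing it out would leave a linear
    syzygy. Together with [q_coprime], which treats affine common roots, this says that q_0 and q_1
    have no common zero on P^1. *)
Let q_top : size q0 = 3 \/ size q1 = 3.
Proof.
have [s0|s0] := leqP (size q0) 2; last by left; apply/eqP; rewrite eqn_leq sq0.
have [s1|s1] := leqP (size q1) 2; last by right; apply/eqP; rewrite eqn_leq sq1.
by case: q_neq0; apply: nolin.
Qed.

Let q_coprime : coprimep q0 q1.
Proof.
apply/negPn/negP; rewrite /coprimep => /closed_rootP [w].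
rewrite root_gcd => /andP [/factor_theorem [r0 e0] /factor_theorem [r1 e1]].
have X0 : 'X - w%:P != 0 by rewrite polyXsubC_eq0.
have sr q r : q = r * ('X - w%:P) -> (size q <= 3)%N -> (size r <= 2)%N.
  move=> ->; have [->|r00] := eqVneq r 0; first by rewrite size_poly0.
  by rewrite size_mul // size_XsubC addn2.
have [] := nolin (sr _ _ e0 sq0) (sr _ _ e1 sq1).
  have XX0 : ('X - w%:P)%:P != 0 :> {poly {poly k}} by rewrite polyC_eq0.
  by apply: (mulfI XX0); rewrite mulr0 -[RHS]Qsyz e0 e1 !polyCM; ring.
by move=> z0 z1; case: q_neq0; rewrite e0 e1 z0 z1 !mul0r.
Qed.

Let q0_neq0 : q0 != 0.
Proof.
apply: contraTneq q_coprime => z; rewrite z coprime0p -size_poly_eq1.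
by case: q_top => e; rewrite ?e //; move: e; rewrite z size_poly0.
Qed.

Let q1_neq0 : q1 != 0.
Proof.
apply: contraTneq q_coprime => z; rewrite z coprimep0 -size_poly_eq1.
by case: q_top => e; rewrite ?e //; move: e; rewrite z size_poly0.
Qed.

Let q0P_neq0 : q0%:P != 0 :> {poly {poly k}}. Proof. by rewrite polyC_eq0. Qed.
Let q1P_neq0 : q1%:P != 0 :> {poly {poly k}}. Proof. by rewrite polyC_eq0. Qed.

(** Coprimality makes q1 divide each coefficient of f0. The drop of the u-degree by 2 is read off
    from whichever of q0, q1 has degree exactly 2. *)
Let coprime_quotient m d f0 f1 : bibound m d.+2 f0 -> bibound m d.+2 f1 ->
  q0%:P * f0 + q1%:P * f1 = 0 ->
  exists g, [/\ bibound m d g, f0 = q1%:P * g & f1 = - (q0%:P * g)].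
Proof.
move=> b0 b1 e.
have dv j : q1 %| f0`_j.
  rewrite -(@Gauss_dvdpr _ _ q0); last by rewrite coprimep_sym.
  move/(congr1 (fun f : {poly {poly k}} => f`_j)): e.
  rewrite coefD !coefCM coef0 => /eqP; rewrite addr_eq0 => /eqP ->.
  by rewrite -mulrN dvdp_mulr.
have e0 : f0 = q1%:P * map_poly (fun q => q %/ q1) f0.
  by apply/polyP=> j; rewrite coefCM coef_map_id0 ?div0p // mulrC divpK.
move: (map_poly _ _) e0 => g e0; have e1 : f1 = - (q0%:P * g).
  by apply: (mulfI q1P_neq0); apply/eqP; rewrite -subr_eq0; apply/eqP; rewrite -[RHS]e e0; ring.
exists g; split=> //; case: q_top => sq.
  apply: (@bibound_div _ m d 2 q0) => //; rewrite addn2.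
  by rewrite -[_ * g]opprK -e1; apply: biboundN.
by apply: (@bibound_div _ m d 2 q1); rewrite // addn2 -e0.
Qed.

(** Two binary quadratic forms without common zero generate all forms of degree at least 3; here b
    >= 3 enters. The multiplier of r1 is the Bezout one reduced modulo r0, which has degree exactly
    2, and so the cofactor of r0 gets the right degree. *)
Let decomp_aux m d (r0 r1 : {poly k}) f : size r0 = 3 -> (size r1 <= 3)%N -> coprimep r0 r1 ->
  bibound m d.+4 f -> exists g h, [/\ bibound m d.+2 g, bibound m d.+2 h & f = r0%:P * g + r1%:P * h].
Proof.
move=> s0 s1 cop bf; have r00 : r0 != 0 by rewrite -size_poly_gt0 s0.
have /Bezout_eq1_coprimepP [[U V] /= UV] := cop.
pose hh q := (q * V) %% r0; pose gg q := (q - hh q * r1) %/ r0.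
have hb q : (size (hh q) <= 2)%N by have := ltn_modp (q * V) r0; rewrite r00 s0.
have ge q : q = r0 * gg q + r1 * hh q.
  have dv : r0 %| q - hh q * r1.
    rewrite (_ : q - hh q * r1 = q * U * r0 + (q * V %/ r0 * r1) * r0).
      by rewrite dvdp_add ?dvdp_mull.
    have e := divp_eq (q * V) r0.
    rewrite (_ : hh q = q * V - q * V %/ r0 * r0); last by rewrite {1}e /hh; ring.
    by rewrite -{1}[q]mulr1 -UV; ring.
  by rewrite /gg [r0 * _]mulrC divpK //; ring.
have h0 : hh 0 = 0 by rewrite /hh mul0r mod0p.
have g0 : gg 0 = 0 by rewrite /gg h0 mul0r subr0 div0p.
exists (map_poly gg f), (map_poly hh f); split.
- apply: bibound_map bf => // q sq; have [->|gn] := eqVneq (gg q) 0; first by rewrite size_poly0.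
  have : (size (r0 * gg q)%R <= d.+4)%N.
    rewrite (_ : r0 * gg q = q - r1 * hh q); last by rewrite {2}(ge q); ring.
    apply: leq_trans (size_polyD _ _) _; rewrite size_polyN geq_max sq /=.
    apply: leq_trans (size_polyMleq _ _) _; rewrite -subn1 leq_subLR.
    exact: leq_trans (leq_add s1 (hb q)) _.
  by rewrite size_mul // s0.
- by apply: bibound_map bf => // q sq; apply: leq_trans (hb q) _.
- by apply/polyP=> j; rewrite coefD !coefCM !coef_map_id0 //; apply: ge.
Qed.

Let coprime_decomp m d f : bibound m d.+4 f ->
  exists g h, [/\ bibound m d.+2 g, bibound m d.+2 h & f = q0%:P * g + q1%:P * h].
Proof.
move=> bf; case: q_top => s; first exact: decomp_aux.
have cop : coprimep q1 q0 by rewrite coprimep_sym.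
have [g [h [bg bh ->]]] := decomp_aux s sq0 cop bf.
by exists h, g; split; rewrite // addrC.
Qed.

Definition Q2 := vec4 q0%:P q1%:P 0 (0 : {poly {poly k}}).

(** With p_0 = q_1 g and p_1 = -q_0 g, a decomposition p_2 = q_0 be + q_1 al multiplied by g reads g
    p_2 = al p_0 - be p_1, which is the syzygy S1. In the same way p_3 gives S2. *)
Theorem rank2_structure : exists S1 S2 : 'I_4 -> {poly {poly k}},
  [/\ [/\ forall i, bibound a.+1 n.+2 (S1 i), \sum_i S1 i * P i = 0 & exists i, S1 i != 0],
      [/\ forall i, bibound a.+1 n.+2 (S2 i), \sum_i S2 i * P i = 0 & exists i, S2 i != 0],
      forall c, (forall i, bibound a.*2 n.+3 (c i)) -> \sum_i c i * P i = 0 ->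
        exists h h1 h2, [/\ bibound a.*2 n.+1 h, bibound a 2 h1, bibound a 2 h2
          & forall i, c i = h * Q2 i + h1 * S1 i + h2 * S2 i]
    & forall h h1 h2, (forall i, h * Q2 i + h1 * S1 i + h2 * S2 i = 0) ->
        [/\ h = 0, h1 = 0 & h2 = 0]].
Proof.
have [g [bg eP0 eP1]] := @coprime_quotient a.+1 n.+2 _ _ (Pb o0) (Pb o1) Qsyz.
have g0 : g != 0 by apply: contraNneq P0_neq0 => z; rewrite eP0 z mulr0.
have [be [al [bbe bal eP2]]] := coprime_decomp (Pb o2).
have [be' [al' [bbe' bal' eP3]]] := coprime_decomp (Pb o3).
exists (vec4 al (- be) (- g) 0), (vec4 al' (- be') 0 (- g)); split.
- split; last by exists o2; rewrite /vec4 /= oppr_eq0.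
  + by apply: forall4; rewrite /vec4 //= ?oppr0; (exact: bibound0) || exact: biboundN.
  + by rewrite sum4 /vec4 /= eP0 eP1 eP2; ring.
- split; last by exists o3; rewrite /vec4 /= oppr_eq0.
  + by apply: forall4; rewrite /vec4 //= ?oppr0; (exact: bibound0) || exact: biboundN.
  + by rewrite sum4 /vec4 /= eP0 eP1 eP3; ring.
- move=> c bc; rewrite sum4 => syz.
  pose e := q1%:P * c o0 - q0%:P * c o1.
  have be1 : bibound a.*2 n.+1.+4 e.
    by apply: biboundB; [apply: (biboundCM sq1) | apply: (biboundCM sq0)].
  have ncz : no_common_zero a n.+1 n.+3 n.+3 g (P o2) (P o3).
    apply: no_common_zero_ev => x [x0 x2 x3]; apply: (Pbpf (x := x)); apply: forall4 => //.
      by rewrite eP0 (@evM _ 0 2 a n.+1) ?x0 ?mulr0 //; apply: biboundC.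
    by rewrite eP1 evN (@evM _ 0 2 a n.+1) ?x0 ?mulr0 ?oppr0 //; apply: biboundC.
  (* D is 2b and the three forms have u-degrees b - 2, b, b, so the bounds become 0 for l0 and 2 for
     l1 and l2. With l0 = 0 the last two entries of c are -g l2 and g l1. *)
  have [|||||||l0 [l1 [l2 [[E0 E1 E2]]]]] := koszul_exact (D := (n + n).+2.+4) ncz bg (Pb o2) (Pb o3)
      (c0 := e) (c1 := c o2) (c2 := c o3).
  + by case: be1.
  + by case: (bc o2).
  + by case: (bc o3).
  + by move=> j; case: be1 => _ /(_ j); lia.
  + by move=> j; case: (bc o2) => _ /(_ j); lia.
  + by move=> j; case: (bc o3) => _ /(_ j); lia.
  + by rewrite -[RHS]syz eP0 eP1 /e; ring.
  rewrite (_ : _ - _ = 0)%N; last by lia.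
  move=> /bibound0_eq z0; rewrite z0 in E1 E2.
  rewrite (_ : _ - _ = 2)%N; last by lia.
  move=> b1 b2.
  have bl l S : bibound a 2 l -> bibound a.+1 n.+2 S -> bibound a.*2 n.+3 (l * S).
    by move=> hl hS; apply: bibound_le (biboundM hl hS); lia.
  (* Subtracting l2 S1 - l1 S2 from c leaves (c0', c1', 0, 0) with q_1 c0' = q_0 c1', hence a
     multiple of Q. *)
  have [|||h [bh eh1 eh0]] := @coprime_quotient a.*2 n.+1
      (c o1 + l2 * be - l1 * be') (- (c o0 - l2 * al + l1 * al')).
  + by apply: biboundB; [apply: biboundD => //; apply: bl | apply: bl].
  + by apply: biboundN; apply: biboundD; [apply: biboundB => //; apply: bl | apply: bl].
  + transitivity (l2 * P o2 - l1 * P o3 - e); first by rewrite eP2 eP3 /e; ring.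
    by rewrite E0; ring.
  exists h, l2, (- l1); split=> //; first exact: biboundN.
  apply: forall4; rewrite /Q2 /vec4 /=.
  + by rewrite -[LHS]opprK [- c o0](_ : _ = - (c o0 - l2 * al + l1 * al') - l2 * al + l1 * al');
      [rewrite eh0; ring | ring].
  + by rewrite [LHS](_ : _ = (c o1 + l2 * be - l1 * be') - l2 * be + l1 * be');
      [rewrite eh1; ring | ring].
  + by rewrite E1; ring.
  + by rewrite E2; ring.
move=> h h1 h2 e; have := e o2; have := e o3; have := e o0.
rewrite /Q2 /vec4 /= !mulr0 !add0r ?addr0 => e0 /eqP.
rewrite mulf_eq0 oppr_eq0 (negPf g0) orbF => /eqP z2 /eqP.
rewrite mulf_eq0 oppr_eq0 (negPf g0) orbF => /eqP z1.
move: e0; rewrite z1 z2 !mul0r !addr0 => /eqP.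
by rewrite mulf_eq0 (negPf q0P_neq0) orbF => /eqP ->.
Qed.

End RankTwo.

(** * Syzygies when dim V = 3 *)

Section RankThree.
Variables (k : closedFieldType) (a n : nat).
Variables (P : 'I_4 -> {poly {poly k}}).
Hypothesis Pb : forall i, bibound a.+1 n.+4 (P i).
Hypothesis Pbpf : forall x, ~ (forall i, ev a n.+3 x (P i) = 0).
Local Notation w := ('X : {poly k}).
Local Notation W := (('X : {poly k})%:P).
Hypothesis Qsyz : W ^+ 2 * P o0 + W * P o1 + P o2 = 0.
Hypothesis P0_neq0 : P o0 != 0.
Hypothesis P2_neq0 : P o2 != 0.

Definition Q3 := vec4 (W ^+ 2) W 1 (0 : {poly {poly k}}).

Let W_neq0 : W != 0. Proof. by rewrite polyC_eq0 polyX_eq0. Qed.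

Let bibound_W m d (f : {poly {poly k}}) : bibound m d f -> bibound m d.+1 (W * f).
Proof. by move=> bf; apply: (biboundCM (n' := 2)) => //; rewrite size_polyX. Qed.

Let bibound_Wdiv m d (f : {poly {poly k}}) : bibound m d.+1 (W * f) -> bibound m d f.
Proof.
by move=> bf; apply: (@bibound_div _ m d 1 w); rewrite ?size_polyX ?addn1.
Qed.

(** For a form of u-degree d, [low] isolates the terms not divisible by u, and [top d] below those
    not divisible by v. *)
Let low (f : {poly {poly k}}) := map_poly (fun q : {poly k} => (q`_0)%:P) f.
Let highW (f : {poly {poly k}}) := map_poly (fun q : {poly k} => q %/ w) f.

Let low_highW f : f = low f + W * highW f.
Proof.
apply/polyP=> j; rewrite coefD coefCM !coef_map_id0 ?div0p ?coef0 ?polyC0 //.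
have e := divp_eq f`_j w; rewrite {1}e addrC mulrC; congr (_ + _).
by rewrite -['X]subr0 -polyC0 modp_XsubC horner_coef0.
Qed.

Let bibound_low m d f : bibound m d f -> bibound m 1 (low f).
Proof.
by apply: bibound_map => [|q _]; rewrite ?coef0 ?polyC0 ?size_polyC_leq1.
Qed.

Let bibound_highW m d f : bibound m d.+1 f -> bibound m d (highW f).
Proof.
apply: bibound_map => [|q]; first by rewrite div0p.
by rewrite size_divp ?polyX_eq0 // size_polyX leq_subLR add1n.
Qed.

Let top d (f : {poly {poly k}}) := map_poly (fun q : {poly k} => (q`_d)%:P) f.

Let bibound_top m d d' f : bibound m d' f -> bibound m 1 (top d f).
Proof.
by apply: bibound_map => [|q _]; rewrite ?coef0 ?polyC0 ?size_polyC_leq1.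
Qed.

Let bibound_sub_top m d f : bibound m d.+1 f -> bibound m d (f - ('X^d)%:P * top d f).
Proof.
move=> [s t]; split.
  apply: leq_trans (size_polyD _ _) _; rewrite size_polyN geq_max s /= mul_polyC.
  by rewrite size_scale -?size_poly_eq0 ?size_polyXn //; apply: leq_trans (size_poly _ _) s.
move=> j; rewrite coefB coefCM coef_map_id0 ?coef0 ?polyC0 //.
apply/leq_sizeP => i; rewrite coefB coefMC coefXn leq_eqVlt => /orP [/eqP <-|lt].
  by rewrite eqxx mul1r subrr.
by rewrite gtn_eqF // mul0r subr0 nth_default // (leq_trans (t j)).
Qed.

Let bibound_Xn m d d' (f : {poly {poly k}}) : bibound m d f -> bibound m (d' + d) (('X^d')%:P * f).
Proof. by move=> bf; apply: (biboundCM (n' := d'.+1)) => //; rewrite size_polyXn. Qed.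

(** With p_0 = v x, p_1 = -(u x + v y), p_2 = u y, write x = u T2 - v T1 and y = u T1 - v T0. Then
    T0 p_0 + T1 p_1 + T2 p_2 = -x y + y x = 0, so S1 is the Koszul relation of x and y in disguise.
    S2 and S3 express x p_3 and y p_3 through p_0, p_1, p_2. *)
Theorem rank3_structure : exists S1 S2 S3 : 'I_4 -> {poly {poly k}},
  [/\ [/\ forall i, bibound a.+1 n.+2 (S1 i), \sum_i S1 i * P i = 0 & exists i, S1 i != 0],
      [/\ forall i, bibound a.+1 n.+3 (S2 i), \sum_i S2 i * P i = 0 & exists i, S2 i != 0],
      [/\ forall i, bibound a.+1 n.+3 (S3 i), \sum_i S3 i * P i = 0 & exists i, S3 i != 0],
      forall c, (forall i, bibound a.*2 n.+3 (c i)) -> \sum_i c i * P i = 0 ->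
        exists h h1 h2 h3, [/\ [/\ bibound a.*2 n.+1 h, bibound a 2 h1,
            bibound a 1 h2 & bibound a 1 h3]
          & forall i, c i = h * Q3 i + h1 * S1 i + h2 * S2 i + h3 * S3 i]
    & forall h h1 h2 h3, bibound a 1 h2 -> bibound a 1 h3 ->
        (forall i, h * Q3 i + h1 * S1 i + h2 * S2 i + h3 * S3 i = 0) ->
        [/\ h = 0, h1 = 0, h2 = 0 & h3 = 0]].
Proof.
pose x := P o0; pose y := highW (P o2).
have eP2 : P o2 = W * y.
  rewrite {1}[P o2]low_highW -/y (_ : low (P o2) = 0) ?add0r //.
  apply/polyP=> j; rewrite coef0 coef_map_id0 ?coef0 ?polyC0 //.
  move/(congr1 (fun f : {poly {poly k}} => (f`_j)`_0)): Qsyz.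
  rewrite -polyC_exp !coefD !coefCM !coef0 coefXM coefXnM /= !add0r => ->.
  by rewrite polyC0.
have eP1 : P o1 = - (W * x + y).
  by apply: (mulfI W_neq0); apply/eqP; rewrite -subr_eq0; apply/eqP; rewrite -[RHS]Qsyz eP2 /x; ring.
have by_ : bibound a.+1 n.+3 y by apply: bibound_Wdiv; rewrite -eP2.
have bx : bibound a.+1 n.+3 x.
  apply: bibound_Wdiv; rewrite (_ : W * x = - (P o1 + y)); last by rewrite eP1; ring.
  apply: biboundN; apply: biboundD => //; exact: bibound_le by_.
have y0 : y != 0 by apply: contraNneq P2_neq0 => z; rewrite eP2 z mulr0.
have ncz : no_common_zero a n.+2 n.+2 n.+3 x y (P o3).
  apply: no_common_zero_ev => p [x0 y00 e3]; apply: (Pbpf (x := p)).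
  have eW f : bibound a.+1 n.+3 f -> ev a n.+2 p f = 0 -> ev a n.+3 p (W * f) = 0.
    move=> bf z; rewrite (@evM _ 0 1 a n.+2) ?z ?mulr0 //.
    by apply: biboundC; rewrite size_polyX.
  have eL f : bibound a.+1 n.+3 f -> ev a n.+2 p f = 0 -> ev a n.+3 p f = 0.
    move=> bf z; rewrite -[f]mul1r -polyC1 (@evM _ 0 1 a n.+2) ?z ?mulr0 //.
    by apply: biboundC; rewrite size_poly1.
  apply: forall4 => //; first exact: eL.
    by rewrite eP1 evN evD eW ?eL ?addr0 ?oppr0.
  by rewrite eP2 eW.
have bW m d f : bibound m d f -> bibound m d.+1 (W * f) by apply: bibound_W.
pose t := top n.+2 y; have bt : bibound a.+1 1 t by apply: bibound_top by_.
(* [T1] is chosen so that w divides [x + T1] and the top coefficient of [W * T1 - y] vanishes. *)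
pose T1 := ('X^(n.+1))%:P * t - low x.
pose T2 := highW x + ('X^n)%:P * t; pose T0 := W * T1 - y.
have ex : x = W * T2 - T1.
  by rewrite {1}[x]low_highW /T2 /T1 exprS polyCM; ring.
have ey : y = W * T1 - T0 by rewrite /T0; ring.
have bT1 : bibound a.+1 n.+2 T1.
  apply: biboundB; first by have := bibound_Xn n.+1 bt; rewrite addn1.
  by apply: bibound_le (bibound_low bx).
have bT2 : bibound a.+1 n.+2 T2.
  apply: biboundD; first exact: bibound_highW.
  by apply: bibound_le (bibound_Xn n bt) => //; rewrite addn1.
have bT0 : bibound a.+1 n.+2 T0.
  rewrite (_ : T0 = - (y - ('X^(n.+2))%:P * t) - W * low x); last first.
    by rewrite /T0 /T1 ['X^(n.+2)]exprS polyCM; ring.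
  apply: biboundB; first exact/biboundN/bibound_sub_top.
  by apply: bibound_le (bW _ _ _ (bibound_low bx)).
pose s := top n.+3 (P o3); have bs : bibound a.+1 1 s by apply: bibound_top (Pb o3).
pose r := P o3 - ('X^(n.+3))%:P * s.
have br : bibound a.+1 n.+3 r by apply: bibound_sub_top.
have er : P o3 = r + W ^+ 2 * ('X^(n.+1))%:P * s.
  by rewrite /r ['X^(n.+3)]exprS ['X^(n.+2)]exprS !polyCM; ring.
pose p := low (P o3); pose q := highW (P o3).
have bp : bibound a.+1 1 p by apply: bibound_low (Pb o3).
have bq : bibound a.+1 n.+3 q by apply: bibound_highW.
have epq : P o3 = p + W * q by apply: low_highW.
pose S1 := vec4 T0 T1 T2 0.
(* At v = 1, S2 uses p_3 = r + u^(n+3) s and u^2 x = -(u p_1 + p_2), whereas S3 uses p_3 = p + u q,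
   y = -(p_1 + u p_0) and u y = p_2. Splitting off one extreme term of p_3 leaves r and q of
   u-degree b - 1. *)
pose S2 := vec4 r (- (W * ('X^(n.+1))%:P * s)) (- (('X^(n.+1))%:P * s)) (- x).
pose S3 := vec4 (- (W * p)) (- p) q (- y).
have syz1 : \sum_i S1 i * P i = 0.
  rewrite sum4 /S1 /vec4 /= eP1 eP2 -/x.
  transitivity (x * (T0 - W * T1) + y * (W * T2 - T1)); first by ring.
  by rewrite -ex {1}ey; ring.
have syz2 : \sum_i S2 i * P i = 0.
  by rewrite sum4 /S2 /vec4 /= eP1 eP2 er -/x; ring.
have syz3 : \sum_i S3 i * P i = 0.
  by rewrite sum4 /S3 /vec4 /= eP1 eP2 epq -/x; ring.
have bXs : bibound a.+1 n.+2 (('X^(n.+1))%:P * s).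
  by have := bibound_Xn n.+1 bs; rewrite addn1.
have bS1 i : bibound a.+1 n.+2 (S1 i).
  by move: i; apply: forall4; rewrite /S1 /vec4 //=; apply: bibound0.
have bS2 i : bibound a.+1 n.+3 (S2 i).
  move: i; apply: forall4; rewrite /S2 /vec4 //=; apply: biboundN => //.
    by rewrite -mulrA; apply: bW.
  exact: bibound_le bXs.
have bS3 i : bibound a.+1 n.+3 (S3 i).
  move: i; apply: forall4; rewrite /S3 /vec4 //=; apply: biboundN => //.
    by apply: bibound_le (bW _ _ _ bp).
  exact: bibound_le bp.
(* The relation is completed by 0 times p_3; for D = b every bound on the multipliers is 0. *)
have xy_free l0 l1 : bibound a 1 l0 -> bibound a 1 l1 -> l0 * x + l1 * y = 0 -> l0 = 0 /\ l1 = 0.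
  move=> [s0 t0] [s1 t1] e.
  have [|||||||m0 [m1 [m2 [[E0 E1 E2]]]]] := koszul_exact (D := n.+3) ncz bx by_ (Pb o3)
    (c0 := l0) (c1 := l1) (c2 := 0).
  - by apply: leq_trans s0 _; lia.
  - by apply: leq_trans s1 _; lia.
  - by rewrite size_poly0.
  - by move=> j; have := t0 j; lia.
  - by move=> j; have := t1 j; lia.
  - by move=> j; rewrite coef0 size_poly0.
  - by rewrite e mul0r addr0.
  rewrite (_ : n.+3 + n.+2 - _ = 0)%N; last by lia.
  rewrite (_ : n.+3 + n.+3 - _ = 0)%N; last by lia.
  move=> /bibound0_eq z0 /bibound0_eq z1 /bibound0_eq z2.
  by rewrite E0 E1 z0 z1 z2; split; ring.
exists S1, S2, S3; split.
- split=> //; apply: NNPP => h; case/eqP: P0_neq0.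
  have z i : S1 i = 0 by apply/eqP/negPn/negP=> si; apply: h; exists i.
  by rewrite -/x ex; have := z o1; have := z o2; rewrite /S1 /vec4 /= => -> ->; rewrite mulr0 subr0.
- by split=> //; exists o3; rewrite /S2 /vec4 /= oppr_eq0.
- by split=> //; exists o3; rewrite /S3 /vec4 /= oppr_eq0.
- move=> c bc; rewrite sum4 => syz.
  have b1 : bibound a.*2 n.+4 (c o0 - W * c o1).
    by apply: biboundB; [apply: bibound_le (bc o0) | apply: bW].
  have b2 : bibound a.*2 n.+4 (W * c o2 - c o1).
    by apply: biboundB; [apply: bW | apply: bibound_le (bc o1)].
  have [|||||||l0 [l1 [l2 [[E0 E1 E2]]]]] := koszul_exact (D := (n + n).+2.+4) ncz bx by_ (Pb o3)
      (c0 := c o0 - W * c o1) (c1 := W * c o2 - c o1) (c2 := c o3).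
  + by case: b1.
  + by case: b2.
  + by case: (bc o3).
  + by move=> j; case: b1 => _ /(_ j); lia.
  + by move=> j; case: b2 => _ /(_ j); lia.
  + by move=> j; case: (bc o3) => _ /(_ j); lia.
  + by rewrite -[RHS]syz eP1 eP2 /x; ring.
  rewrite (_ : _ - _ = 1)%N; last by lia.
  rewrite (_ : _ - _ = 2)%N; last by lia.
  move=> bl0 bl1 bl2 {E0 E1 b1 b2}.
  (* Exactness gave c_3 = x l1 - y l0, and S2, S3 end in -x, -y, so the last entry of d is zero. A
     second use of exactness then treats d. *)
  pose d i := c i + l1 * S2 i - l0 * S3 i.
  have bd i : bibound a.*2 n.+3 (d i).
    by apply: biboundB; [apply: biboundD => //; apply: bibound_le (biboundM bl1 (bS2 i)); lia
                        | apply: bibound_le (biboundM bl0 (bS3 i)); lia].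
  have d3 : d o3 = 0 by rewrite /d /S2 /S3 /vec4 /= E2; ring.
  have syzd : (d o0 - W * d o1) * x + (W * d o2 - d o1) * y = 0.
    transitivity (\sum_i d i * P i).
      by rewrite sum4 d3 eP1 eP2 /x; ring.
    transitivity (\sum_i c i * P i + l1 * (\sum_i S2 i * P i) - l0 * (\sum_i S3 i * P i)).
      by rewrite !sum4 /d; ring.
    by rewrite syz2 syz3 !mulr0 subr0 addr0 sum4.
  have b1 : bibound a.*2 n.+4 (d o0 - W * d o1).
    by apply: biboundB; [apply: bibound_le (bd o0) | apply: bW].
  have b2 : bibound a.*2 n.+4 (W * d o2 - d o1).
    by apply: biboundB; [apply: bW | apply: bibound_le (bd o1)].
  have [|||||||m0 [m1 [m2 [[E0 E1 E3]]]]] := koszul_exact (D := (n + n).+2.+4) ncz bx by_ (Pb o3)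
      (c0 := d o0 - W * d o1) (c1 := W * d o2 - d o1) (c2 := 0).
  + by case: b1.
  + by case: b2.
  + by rewrite size_poly0.
  + by move=> j; case: b1 => _ /(_ j); lia.
  + by move=> j; case: b2 => _ /(_ j); lia.
  + by move=> j; rewrite coef0 size_poly0; lia.
  + by rewrite -[RHS]syzd; ring.
  rewrite (_ : _ - _ = 1)%N; last by lia.
  rewrite (_ : _ - _ = 2)%N; last by lia.
  move=> bm0 bm1 bm2.
  have [|z1 z0] := @xy_free m1 (- m0) bm1 (biboundN bm0); first by rewrite E3; ring.
  move/eqP: z0; rewrite oppr_eq0 => /eqP z0; rewrite z0 z1 in E0 E1.
  have F0 : d o0 = W * d o1 + y * m2 by rewrite -[d o0](subrK (W * d o1)) E0; ring.
  have F1 : d o1 = W * d o2 + x * m2.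
    by transitivity (W * d o2 - (W * d o2 - d o1)); [ring | rewrite E1; ring].
  (* Now d_0 - u d_1 = m2 y and u d_2 - d_1 = -m2 x. Replacing x and y by their expressions in the
     T_i makes d + m2 S1 equal to h times (u^2, u, 1, 0). *)
  pose h := d o2 + m2 * T2.
  have G1 : d o1 + m2 * T1 = W * h by rewrite F1 {1}ex /h; ring.
  have G0 : d o0 + m2 * T0 = W * (W * h) by rewrite -G1 F0 {1}ey; ring.
  exists h, (- m2), (- l1), l0; split.
    split=> //; try exact: biboundN.
    do 2!apply: bibound_Wdiv; rewrite -G0; apply: biboundD => //.
    by apply: bibound_le (biboundM bm2 bT0); lia.
  have ec i : c i = d i - l1 * S2 i + l0 * S3 i by rewrite /d; ring.
  apply: forall4; rewrite ec; congr (_ + _); rewrite ?mulNr; congr (_ - _); rewrite /Q3 /S1 /vec4 /=.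
  + by transitivity (W * (W * h) - m2 * T0); [rewrite -G0; ring | ring].
  + by transitivity (W * h - m2 * T1); [rewrite -G1; ring | ring].
  + by rewrite /h; ring.
  + by rewrite d3; ring.
(* The syzygy module has rank 3, so four generators can be independent only in bounded degree. The
   bounds on h2 and h3 rule out the multipliers y and -x, for which the last entries of S2 and S3
   cancel. *)
- move=> h h1 h2 h3 b2 b3 e.
  have [|z2 z3] := @xy_free h2 h3 b2 b3.
    have := e o3; rewrite /Q3 /S1 /S2 /S3 /vec4 /= !mulr0 !add0r => e3.
    by rewrite -[RHS]oppr0 -e3; ring.
  have e' i : h * Q3 i + h1 * S1 i = 0 by rewrite -[RHS](e i) z2 z3; ring.
  have /eqP : h1 * y = 0.
    have := e' o0; have := e' o1; rewrite /Q3 /S1 /vec4 /= => e1 e0.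
    transitivity (W * (h * W + h1 * T1) - (h * W ^+ 2 + h1 * T0)); first by rewrite {1}ey; ring.
    by rewrite e1 e0; ring.
  rewrite mulf_eq0 (negPf y0) orbF => /eqP z1.
  by split=> //; have := e' o2; rewrite z1 /Q3 /vec4 /= mul0r addr0 mulr1.
Qed.

End RankThree.

(** * Dehomogenisation *)

Section LinAlg.
Variables (k : fieldType) (L : lmodType k).

Lemma has_dim_fin (I : finType) (W : L -> Prop) (e : I -> L) :
  (forall c : I -> k, \sum_i c i *: e i = 0 -> forall i, c i = 0) ->
  (forall x, W x <-> exists c : I -> k, x = \sum_i c i *: e i) ->
  has_dim W #|I|.
Proof.
move=> free span; exists (fun j => e (enum_val j)).
have sumE (c : I -> k) : \sum_i c i *: e i = \sum_(j < #|I|) c (enum_val j) *: e (enum_val j).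
  by rewrite (reindex (@enum_val I I)) //; apply/onW_bij/enum_val_bij.
split.
  move=> c c0 i; rewrite -[i](enum_valK); apply: (free (fun x => c (enum_rank x))).
  by rewrite sumE -[RHS]c0; apply: eq_bigr => j _; rewrite enum_valK.
move=> x; rewrite span; split=> [] [c ->].
  by exists (fun j => c (enum_val j)); rewrite sumE.
exists (fun x => c (enum_rank x)); rewrite sumE.
by apply: eq_bigr => j _; rewrite enum_valK.
Qed.

End LinAlg.

Section Dehom.
Variable k : closedFieldType.
Local Notation R := {mpoly k[4]}.
Local Notation BP := {poly {poly k}}.
Implicit Types (f g : R) (m : 'X_{1..4}).

Lemma bihom0 c d : bihom c d (0 : R).
Proof. by move=> m; rewrite msupp0. Qed.

Lemma bihomD c d f g : bihom c d f -> bihom c d g -> bihom c d (f + g).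
Proof.
move=> hf hg m /msuppD_le; rewrite mem_cat => /orP [/hf|/hg] //.
Qed.

Lemma bihomZ c d (x : k) f : bihom c d f -> bihom c d (x *: f).
Proof. by move=> hf m /msuppZ_le /hf. Qed.

Lemma bihom_sum c d (I : finType) (F : I -> R) : (forall i, bihom c d (F i)) -> bihom c d (\sum_i F i).
Proof. by move=> h; apply: big_ind => //; [exact: bihom0 | exact: bihomD]. Qed.

Lemma bihomX m c d : (m vs + m vt = c)%N -> (m vu + m vv = d)%N -> bihom c d ('X_[m] : R).
Proof. by move=> e1 e2 m'; rewrite msuppX inE => /eqP ->. Qed.

Lemma bihomM c d c' d' f g : bihom c d f -> bihom c' d' g -> bihom (c + c') (d + d') (f * g).
Proof.
move=> hf hg m /msuppM_le /allpairsP [[m1 m2] /= [/hf [<- <-] /hg [<- <-] ->]].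
by rewrite !mnmDE; split; lia.
Qed.

Lemma bihom_ind c d (Pr : R -> Prop) : Pr 0 ->
  (forall f g, Pr f -> Pr g -> Pr (f + g)) ->
  (forall (x : k) m, (m vs + m vt = c)%N -> (m vu + m vv = d)%N -> Pr (x *: 'X_[m])) ->
  forall f, bihom c d f -> Pr f.
Proof.
move=> h0 hD hX f hf; rewrite (mpolyE f) big_seq; apply: big_ind => // m /hf [e1 e2].
exact: hX.
Qed.

Definition dehom_var : 'I_4 -> BP := vec4 'X 1 ('X)%:P 1.

Definition dehom : R -> BP := mmap (polyC \o polyC) dehom_var.

HB.instance Definition _ := GRing.RMorphism.on dehom.

Lemma dehomX m : dehom 'X_[m] = 'X^(m vs) * ('X^(m vu))%:P.
Proof.
rewrite /dehom mmapX /mmap1 prod4 /dehom_var /vec4 /=.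
by rewrite !expr1n !mulr1 polyC_exp; congr (_ ^+ m _ * _ ^+ m _); apply: val_inj.
Qed.

Lemma dehomZ (x : k) f : dehom (x *: f) = x%:P%:P * dehom f.
Proof. by rewrite /dehom mmapZ. Qed.

Definition mon c d i j : 'X_{1..4} := [multinom vec4 i (c - i)%N j (d - j)%N l | l < 4].

Definition hom c d (F : BP) : R := \sum_(i < c.+1) \sum_(j < d.+1) (F`_i)`_j *: 'X_[mon c d i j].

Lemma mon_vs c d i j : mon c d i j vs = i. Proof. by rewrite mnmE. Qed.
Lemma mon_vu c d i j : mon c d i j vu = j. Proof. by rewrite mnmE. Qed.

Lemma bihom_mon c d i j : (i <= c)%N -> (j <= d)%N -> bihom c d ('X_[mon c d i j] : R).
Proof. by move=> ic jd; apply: bihomX; rewrite !mnmE /vec4 /= subnKC. Qed.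

Lemma mon_eq m c d : (m vs + m vt = c)%N -> (m vu + m vv = d)%N -> mon c d (m vs) (m vu) = m.
Proof.
move=> e1 e2; apply/mnmP; apply: forall4; rewrite mnmE /vec4 /= -?e1 -?e2 ?addKn //; congr (m _); exact: val_inj.
Qed.

Lemma homD c d F G : hom c d (F + G) = hom c d F + hom c d G.
Proof.
rewrite /hom -big_split; apply: eq_bigr => i _; rewrite -big_split; apply: eq_bigr => j _.
by rewrite !coefD scalerDl.
Qed.

Lemma hom0 c d : hom c d 0 = 0.
Proof. by rewrite /hom big1 // => i _; rewrite big1 // => j _; rewrite !coef0 scale0r. Qed.

Lemma homZ c d (x : k) F : hom c d (x%:P%:P * F) = x *: hom c d F.
Proof.
rewrite /hom scaler_sumr; apply: eq_bigr => i _; rewrite scaler_sumr; apply: eq_bigr => j _.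
by rewrite !coefCM scalerA.
Qed.

Lemma bihom_hom c d F : bihom c d (hom c d F).
Proof.
by do 2 (apply: bihom_sum => ?); apply/bihomZ/bihom_mon; rewrite -ltnS.
Qed.

Lemma poly_sum_coef (T : nzRingType) n (F : {poly T}) : (size F <= n)%N ->
  F = \sum_(i < n) F`_i *: 'X^i.
Proof.
move=> s; rewrite -poly_def; apply/polyP => i; rewrite coef_poly.
by case: ltnP => // ni; rewrite nth_default // (leq_trans s).
Qed.

Lemma homK c d F : bibound c.+1 d.+1 F -> dehom (hom c d F) = F.
Proof.
move=> [s t]; rewrite [RHS](poly_sum_coef s) /hom rmorph_sum; apply: eq_bigr => i _ /=.
rewrite rmorph_sum [in RHS](poly_sum_coef (t i)) -mul_polyC rmorph_sum mulr_suml.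
apply: eq_bigr => j _ /=; rewrite dehomZ dehomX mon_vs mon_vu -mul_polyC polyCM; ring.
Qed.

Lemma dehomK c d f : bihom c d f -> hom c d (dehom f) = f.
Proof.
apply: (@bihom_ind c d (fun f => hom c d (dehom f) = f)) => [|f' g ef eg|x m e1 e2] /=; first by rewrite rmorph0 hom0.
  by rewrite rmorphD homD ef eg.
rewrite dehomZ homZ; congr (_ *: _); rewrite dehomX.
have lt1 : (m vs < c.+1)%N by lia.
have lt2 : (m vu < d.+1)%N by lia.
rewrite /hom (bigD1 (Ordinal lt1)) //= [X in _ + X]big1 ?addr0; last first.
  move=> i; rewrite -val_eqE /= => ni; rewrite big1 // => j _.
  by rewrite coefMC coefXn (negPf ni) mul0r coef0 scale0r.
rewrite (bigD1 (Ordinal lt2)) //= [X in _ + X]big1 ?addr0; last first.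
  move=> j; rewrite -val_eqE /= => nj.
  by rewrite coefMC coefXn eqxx mul1r coefXn (negPf nj) scale0r.
by rewrite coefMC coefXn eqxx mul1r coefXn eqxx scale1r mon_eq.
Qed.

Lemma bibound_dehom c d f : bihom c d f -> bibound c.+1 d.+1 (dehom f).
Proof.
apply: (@bihom_ind c d (fun f => bibound c.+1 d.+1 (dehom f))) => [|f' g ef eg|x m e1 e2] /=; first by rewrite rmorph0; apply: bibound0.
  by rewrite rmorphD; apply: biboundD.
rewrite dehomZ dehomX mulrCA; split.
  apply: leq_trans (size_polyMleq _ _) _; rewrite size_polyXn /= -polyCM.
  have := size_polyC_leq1 (x%:P * 'X^(m vu)); move: (size _) => z; lia.
move=> j; rewrite -polyCM coefMC coefXn; case: eqP => _; last by rewrite mul0r size_poly0.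
rewrite mul1r mul_polyC; apply: leq_trans (size_scale_leq _ _) _; rewrite size_polyXn; lia.
Qed.

Lemma dehom_inj c d f g : bihom c d f -> bihom c d g -> dehom f = dehom g -> f = g.
Proof. by move=> hf hg e; rewrite -(dehomK hf) e dehomK. Qed.

Lemma dehom_eq0 c d f : bihom c d f -> dehom f = 0 -> f = 0.
Proof. by move=> hf e; rewrite -(dehomK hf) e hom0. Qed.

Lemma homM c d c' d' F G : bibound c.+1 d.+1 F -> bibound c'.+1 d'.+1 G ->
  hom (c + c') (d + d') (F * G) = hom c d F * hom c' d' G.
Proof.
move=> bF bG; apply: (@dehom_inj (c + c') (d + d')).
- exact: bihom_hom.
- by apply: bihomM; apply: bihom_hom.
rewrite rmorphM /= !homK //; apply: bibound_le (biboundM bF bG); lia.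
Qed.

Definition pt_coord (x : pt k) : 'I_4 -> k :=
  vec4 (if x.1 is Some z then z else 1) (if x.1 is Some z then 1 else 0)
       (if x.2 is Some w then w else 1) (if x.2 is Some w then 1 else 0).

Lemma pt_coord_point x : is_P1P1_point (pt_coord x).
Proof.
by case: x => [[z|] [w|]]; split; rewrite /pt_coord /vec4 /= ?oner_neq0; (right + left).
Qed.

Lemma evZ a b x (c : k) (F : BP) : ev a b x (c%:P%:P * F) = c * ev a b x F.
Proof.
have e0 (h : {poly k} -> k) : h 0 = 0 -> (forall q : {poly k}, h (c%:P * q) = c * h q) ->
    map_poly h (c%:P%:P * F) = c%:P * map_poly h F :> {poly k}.
  move=> h0 hc; apply/polyP=> i; rewrite coef_map_id0 // !coefCM hc.
  by rewrite coef_map_id0.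
case: x => -[z|] [w|]; rewrite /ev /= /fib /fib_inf e0 ?hornerM ?hornerC ?coefCM //=.
all: rewrite ?/horner_eval ?horner0 ?coef0 // => q.
all: by rewrite ?hornerM ?hornerC ?coefCM.
Qed.

Lemma ev_dehom a b x f : bihom a b f -> f.@[pt_coord x] = ev a b x (dehom f).
Proof.
apply: (@bihom_ind a b (fun f => f.@[pt_coord x] = ev a b x (dehom f))) => [|f' g ef eg|c m e1 e2] /=.
- by rewrite meval0 rmorph0; case: x => -[z|] [w|]; rewrite /ev /= /fib /fib_inf map_poly0 ?horner0 ?coef0.
- by rewrite mevalD rmorphD evD ef eg.
rewrite mevalZ dehomZ evZ; congr (_ * _); rewrite mevalX dehomX.
rewrite prod4 (_ : o0 = vs) 1?(_ : o1 = vt) 1?(_ : o2 = vu) 1?(_ : o3 = vv); try exact: val_inj.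
rewrite /pt_coord /vec4 /=.
have fibE w : fib w ('X^(m vs) * ('X^(m vu))%:P) = 'X^(m vs) * (w ^+ m vu)%:P :> {poly k}.
  by rewrite /fib rmorphM /= map_polyXn map_polyC /= /horner_eval hornerXn.
have infE : fib_inf b ('X^(m vs) * ('X^(m vu))%:P) = 'X^(m vs) * ((m vv == 0%N)%:R)%:P :> {poly k}.
  apply/polyP => i; rewrite coef_map /= !coefMC !coefXn.
  case: (i == m vs); rewrite ?mul0r ?coef0 // !mul1r coefXn.
  by congr (_%:R); congr nat_of_bool; apply/eqP/eqP; lia.
have topE : (a == m vs) = (m vt == 0%N) by apply/eqP/eqP; lia.
by case: x => -[z|] [w|] /=; rewrite /ev /= ?fibE ?infE ?hornerM ?hornerXn ?hornerC ?coefMC ?coefXn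
  ?topE ?expr1n ?expr0n ?mul1r ?mulr1.
Qed.

End Dehom.

(** * Change of generators *)

Section SpanRank.
Variables (k : fieldType) (L : lmodType k).

Lemma comb_mulmx m n r (X : 'M[k]_(m, n)) (Y : 'M[k]_(n, r)) (p : 'I_r -> L) i :
  \sum_j X i j *: (\sum_l Y j l *: p l) = \sum_l (X *m Y) i l *: p l.
Proof.
under eq_bigr do rewrite scaler_sumr; rewrite exchange_big; apply: eq_bigr => l _ /=.
by rewrite mxE scaler_suml; apply: eq_bigr => j _; rewrite scalerA.
Qed.

Lemma kfree_mx n m (p : 'I_n -> L) (X Y : 'M[k]_(m, n)) : kfree p ->
  (forall i, \sum_l X i l *: p l = \sum_l Y i l *: p l) -> X = Y.
Proof.
move=> fr e; apply/matrixP=> i j; apply/eqP; rewrite -subr_eq0; apply/eqP.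
apply: (fr (fun l => X i l - Y i l)).
under eq_bigr do rewrite scalerBl; by rewrite sumrB e subrr.
Qed.

(** X and Y express the basis e in terms of f and conversely. X C has rank n because e is free, and
    C = Y (X C) shows that C has no larger rank. *)
Lemma has_dim_rank m n r (p : 'I_r -> L) (C : 'M[k]_(m, r)) (f : 'I_m -> L) : kfree p ->
  (forall j, f j = \sum_i C j i *: p i) -> has_dim (kspan f) n -> \rank C = n.
Proof.
move=> fr ef [e [efr esp]].
have [X eX] : exists X : 'M[k]_(n, m), forall i, e i = \sum_j X i j *: f j.
  have /fin_all_exists [X eX] : forall i, exists x : 'I_m -> k, e i = \sum_j x j *: f j.
    move=> i; apply: (proj2 (esp (e i))); exists (fun j => (j == i)%:R).
    rewrite (bigD1 i) //= eqxx scale1r [X in _ + X]big1 ?addr0 // => j /negPf ->.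
    by rewrite scale0r.
  by exists (\matrix_(i, j) X i j) => i; rewrite eX; apply: eq_bigr => j _; rewrite mxE.
have [Y eY] : exists Y : 'M[k]_(m, n), forall j, f j = \sum_i Y j i *: e i.
  have /fin_all_exists [Y eY] : forall j, exists y : 'I_n -> k, f j = \sum_i y i *: e i.
    move=> j; apply: (proj1 (esp (f j))); exists (fun l => (l == j)%:R).
    rewrite (bigD1 j) //= eqxx scale1r [X in _ + X]big1 ?addr0 // => l /negPf ->.
    by rewrite scale0r.
  by exists (\matrix_(i, j) Y i j) => i; rewrite eY; apply: eq_bigr => j _; rewrite mxE.
have eXC i : e i = \sum_l (X *m C) i l *: p l.
  by rewrite eX -comb_mulmx; apply: eq_bigr => j _; rewrite ef.
have CE : C = Y *m (X *m C).
  apply: (kfree_mx fr) => j; rewrite -ef eY -comb_mulmx; apply: eq_bigr => i _.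
  by rewrite eXC.
have /eqP rXC : row_free (X *m C).
  rewrite -kermx_eq0; apply/rowV0P => v /sub_kermxP vXC.
  apply/rowP=> i; rewrite [RHS]mxE; apply: (efr (fun i => v 0 i)).
  under eq_bigr do rewrite eXC; rewrite comb_mulmx vXC big1 // => l _.
  by rewrite mxE scale0r.
apply/eqP; rewrite eqn_leq -{2}rXC mxrankM_maxr andbT -[n in (_ <= n)%N]rXC.
by rewrite {1}CE mxrankM_maxr.
Qed.

End SpanRank.

(** * Transport of syzygies along a change of generators *)

Section Transfer.
Variables (k : closedFieldType) (a b : nat).
Local Notation R := {mpoly k[4]}.
Local Notation BP := {poly {poly k}}.
Local Notation R4 := {ffun 'I_4 -> R}.
Variables (p : 'I_4 -> R) (A : 'M[k]_4).
Hypothesis p_bideg : forall i, bihom a b (p i).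
Hypothesis p_free : kfree p.
Hypothesis p_bpf : basepoint_free p.
Hypothesis Au : A \in unitmx.

Definition new_gen i := dehom (\sum_l A i l *: p l).

Lemma bihom_comb c d (x : 'I_4 -> R) (f : 'I_4 -> k) :
  (forall i, bihom c d (x i)) -> bihom c d (\sum_l f l *: x l).
Proof. by move=> hx; apply: bihom_sum => i; apply: bihomZ. Qed.

Lemma new_gen_bound i : bibound a.+1 b.+1 (new_gen i).
Proof. exact/bibound_dehom/bihom_comb. Qed.

Lemma new_gen_bpf x : ~ (forall i, ev a b x (new_gen i) = 0).
Proof.
move=> h; have [i] := p_bpf (pt_coord_point x); apply/negP/negPn/eqP.
pose y := \col_l (p l).@[pt_coord x].
suff /(congr1 (fun M : 'M_(_, _) => M i 0)) : y = 0 by rewrite !mxE.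
have Ay : A *m y = 0.
  apply/matrixP=> j z; rewrite mxE [RHS]mxE -[RHS](h j) -ev_dehom; last exact: bihom_comb.
  by rewrite rmorph_sum; apply: eq_bigr => l _; rewrite mxE /= mevalZ.
by rewrite -(mulKmx Au y) Ay mulmx0.
Qed.

Lemma new_gen_neq0 i : new_gen i != 0.
Proof.
apply/eqP=> /(dehom_eq0 (bihom_comb p_bideg)) /p_free z.
have : (A *m invmx A) i i = 0.
  by rewrite mxE big1 // => l _; rewrite z mul0r.
by rewrite mulmxV // mxE eqxx => /eqP; rewrite oner_eq0.
Qed.

(** Since v.(A p) = (A^T v).p, a syzygy of the new generators A p becomes one of p by applying the
    transpose of A; [coords] applies the inverse of that transpose. *)
Definition lift_vec c d (v : 'I_4 -> BP) : R4 :=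
  [ffun l => \sum_i A i l *: hom c d (v i)].

Definition coords (x : R4) (i : 'I_4) : BP := dehom (\sum_l (invmx A) l i *: x l).

Lemma bihom4_lift c d v : bihom4 c d (lift_vec c d v).
Proof. by move=> l; rewrite ffunE; apply: bihom_comb => i; apply: bihom_hom. Qed.

Lemma coords_bound c d x i : bihom4 c d x -> bibound c.+1 d.+1 (coords x i).
Proof. by move=> hx; apply/bibound_dehom/bihom_comb. Qed.

Lemma mul_inv_sum (V : lmodType k) (X Y : 'M[k]_4) (x : 'I_4 -> V) i : X *m Y = 1%:M ->
  \sum_l X i l *: (\sum_j Y l j *: x j) = x i.
Proof.
move=> e; rewrite comb_mulmx e (bigD1 i) //= mxE eqxx scale1r [X in _ + X]big1 ?addr0 // => j ji.
by rewrite mxE eq_sym (negPf ji) scale0r.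
Qed.

Lemma lift_vecK c d v i : bibound c.+1 d.+1 (v i) -> coords (lift_vec c d v) i = v i.
Proof.
move=> bv; rewrite /coords -[RHS](homK bv); congr dehom.
rewrite -[RHS](mul_inv_sum (X := (invmx A)^T) (Y := A^T) (fun j => hom c d (v j))).
  apply: eq_bigr => l _; rewrite mxE ffunE; congr (_ *: _).
  by apply: eq_bigr => j _; rewrite mxE.
by rewrite -trmx_mul mulmxV // trmx1.
Qed.

Lemma coordsK c d x : bihom4 c d x -> lift_vec c d (coords x) = x.
Proof.
move=> hx; apply/ffunP=> l; rewrite ffunE.
rewrite -[RHS](mul_inv_sum (X := A^T) (Y := (invmx A)^T) x).
  apply: eq_bigr => i _; rewrite mxE dehomK; last exact: bihom_comb.
  by congr (_ *: _); apply: eq_bigr => j _; rewrite mxE.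
by rewrite -trmx_mul mulVmx // trmx1.
Qed.

Lemma lift_vec_syz c d v : (forall i, bibound c.+1 d.+1 (v i)) ->
  in_syz p (lift_vec c d v) <-> \sum_i v i * new_gen i = 0.
Proof.
move=> bv; rewrite /in_syz; set s := \sum_i _.
have es : s = \sum_i hom c d (v i) * \sum_l A i l *: p l.
  rewrite /s; under eq_bigr do rewrite ffunE mulr_suml.
  rewrite exchange_big; apply: eq_bigr => i _ /=; rewrite mulr_sumr.
  by apply: eq_bigr => l _; rewrite -scalerAl -scalerAr.
have ds : dehom s = \sum_i v i * new_gen i.
  by rewrite es rmorph_sum; apply: eq_bigr => i _; rewrite rmorphM /= homK.
rewrite -ds; split=> [->|]; first exact: rmorph0.
apply: (@dehom_eq0 _ (c + a) (d + b)); rewrite es; apply: bihom_sum => i.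
by apply: bihomM; [apply: bihom_hom | apply: bihom_comb].
Qed.

Section Generators.
Variables (m c d : nat) (c1 c2 e1 e2 : 'I_m -> nat) (V : 'I_m -> 'I_4 -> BP).
Hypothesis ec : forall j, (e1 j + c1 j = c)%N.
Hypothesis ed : forall j, (e2 j + c2 j = d)%N.
Hypothesis Vb : forall j i, bibound (c1 j).+1 (c2 j).+1 (V j i).
Hypothesis Vsyz : forall j, \sum_i V j i * new_gen i = 0.
Hypothesis Vgen : forall v, (forall i, bibound c.+1 d.+1 (v i)) -> \sum_i v i * new_gen i = 0 ->
  exists h : 'I_m -> BP, (forall j, bibound (e1 j).+1 (e2 j).+1 (h j)) /\
    forall i, v i = \sum_j h j * V j i.
Hypothesis Vfree : forall h : 'I_m -> BP, (forall j, bibound (e1 j).+1 (e2 j).+1 (h j)) ->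
  (forall i, \sum_j h j * V j i = 0) -> forall j, h j = 0.

Let G j := lift_vec (c1 j) (c2 j) (V j).

Lemma syz_part_gens x : syz_part p c d x -> exists h : 'I_m -> BP,
  (forall j, bibound (e1 j).+1 (e2 j).+1 (h j)) /\
  forall l, x l = \sum_j hom (e1 j) (e2 j) (h j) * G j l.
Proof.
move=> [sx bx].
have bv i : bibound c.+1 d.+1 (coords x i) by apply: coords_bound.
have sv : in_syz p (lift_vec c d (coords x)) by rewrite coordsK.
have [h [bh eh]] := Vgen bv (proj1 (lift_vec_syz bv) sv).
exists h; split=> // l; rewrite -[in LHS](coordsK bx) ffunE.
transitivity (\sum_i A i l *: \sum_j hom c d (h j * V j i)).
  apply: eq_bigr => i _; rewrite eh; congr (_ *: _).
  by apply: (big_morph (hom c d)); [exact: homD | exact: hom0].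
under eq_bigr do rewrite scaler_sumr.
rewrite exchange_big; apply: eq_bigr => j _ /=; rewrite ffunE mulr_sumr.
by apply: eq_bigr => i _; rewrite -{1}(ec j) -{1}(ed j) homM // scalerAr.
Qed.

Lemma gens_free (h : 'I_m -> BP) : (forall j, bibound (e1 j).+1 (e2 j).+1 (h j)) ->
  (forall l, \sum_j hom (e1 j) (e2 j) (h j) * G j l = 0) -> forall j, h j = 0.
Proof.
move=> bh eh; apply: Vfree => // i.
transitivity (dehom (\sum_l invmx A l i *: \sum_j hom (e1 j) (e2 j) (h j) * G j l)).
  under [in RHS]eq_bigr do rewrite scaler_sumr.
  rewrite exchange_big rmorph_sum; apply: eq_bigr => j _ /=.
  rewrite -[in LHS](@lift_vecK (c1 j) (c2 j) (V j) i (Vb j i)) -[h j in LHS](homK (bh j)).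
  rewrite -rmorphM mulr_sumr /=; congr dehom; apply: eq_bigr => l _.
  by rewrite scalerAr.
by rewrite big1 ?rmorph0 // => l _; rewrite eh scaler0.
Qed.

Lemma gens_syz_part j : syz_part p (c1 j) (c2 j) (G j).
Proof. by split; [apply/lift_vec_syz | apply: bihom4_lift]. Qed.

Lemma gens_comb_syz (h : 'I_m -> R) (x : R4) : (forall l, x l = \sum_j h j * G j l) -> in_syz p x.
Proof.
move=> ex; rewrite /in_syz; under eq_bigr do rewrite ex mulr_suml.
rewrite exchange_big big1 // => j _ /=.
under eq_bigr do rewrite -mulrA.
by rewrite -mulr_sumr; have [-> _] := gens_syz_part j; rewrite mulr0.
Qed.

(** A basis consists of the products of G j with the monomials of bidegree (e1 j, e2 j). They are
    indexed by a dependent sum because that bidegree varies with j. *)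
Lemma syz_part_dim : has_dim (syz_part p c d) (\sum_j (e1 j).+1 * (e2 j).+1)%N.
Proof.
pose T j := ('I_(e1 j).+1 * 'I_(e2 j).+1)%type; pose I := {j : 'I_m & T j}.
pose e (i : I) : R4 := [ffun l => 'X_[mon (e1 (tag i)) (e2 (tag i)) (tagged i).1 (tagged i).2] * G (tag i) l].
pose pol (f : I -> k) j : BP := \poly_(i1 < (e1 j).+1) \poly_(i2 < (e2 j).+1)
   f (existT T j (inord i1, inord i2)).
have bpol f j : bibound (e1 j).+1 (e2 j).+1 (pol f j).
  split; first exact: size_poly.
  by move=> i; rewrite coef_poly; case: ifP => _; rewrite ?size_poly0 ?size_poly.
have sumE f l : (\sum_i f i *: e i) l = \sum_j hom (e1 j) (e2 j) (pol f j) * G j l.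
  rewrite sum_ffunE.
  transitivity (\sum_j \sum_(q : 'I_(e1 j).+1 * 'I_(e2 j).+1)
     f (existT T j q) *:
     ('X_[mon (e1 j) (e2 j) q.1 q.2] * G j l)).
    rewrite sig_big_dep /=; apply: eq_bigr => -[j q] _ /=.
    by rewrite !ffunE.
  apply: eq_bigr => j _; rewrite /hom mulr_suml.
  under [in RHS]eq_bigr do rewrite mulr_suml.
  rewrite pair_bigA; apply: eq_bigr => -[i1 i2] _ /=.
  by rewrite coef_poly ltn_ord coef_poly ltn_ord !inord_val scalerAl.
rewrite (_ : \sum_j _ = #|{: I}|)%N; last first.
  rewrite card_tagged sumnE big_map big_enum; apply: eq_bigr => j _.
  by rewrite card_prod !card_ord.
apply: (@has_dim_fin _ _ _ _ e).
  move=> f /ffunP f0; have z := gens_free (bpol f) (fun l => etrans (esym (sumE f l)) (etrans (f0 l) (ffunE _ _))).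
  move=> [j [i1 i2]]; have := congr1 (fun F : BP => (F`_i1)`_i2) (z j).
  by rewrite !coef0 coef_poly ltn_ord coef_poly ltn_ord !inord_val.
move=> x; split.
  move=> /syz_part_gens [h [bh eh]].
  exists (fun i : I => ((h (tag i))`_(tagged i).1)`_(tagged i).2).
  apply/ffunP=> l; rewrite sumE eh; apply: eq_bigr => j _; congr (hom _ _ _ * _).
  apply/polyP=> i1; rewrite coef_poly; case: ltnP => [l1|g1]; last first.
    by have [s _] := bh j; rewrite nth_default // (leq_trans s).
  apply/polyP=> i2; rewrite coef_poly; case: ltnP => [l2|g2]; last first.
    by have [_ s] := bh j; rewrite nth_default // (leq_trans (s i1)).
  by rewrite /= !inordK.
move=> [f ->]; split.
  exact: (gens_comb_syz (h := fun j => hom (e1 j) (e2 j) (pol f j)) (sumE f)).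
move=> l; rewrite sumE; apply: bihom_sum => j; rewrite -(ec j) -(ed j).
by apply: bihomM; [exact: bihom_hom | exact: bihom4_lift].
Qed.

End Generators.

Lemma gens_Rspan c d (Gs : seq R4) (c1 c2 e1 e2 : 'I_(size Gs) -> nat) (V : 'I_(size Gs) -> 'I_4 -> BP) :
  (forall j, (e1 j + c1 j = c)%N) -> (forall j, (e2 j + c2 j = d)%N) ->
  (forall j i, bibound (c1 j).+1 (c2 j).+1 (V j i)) ->
  (forall j, \sum_i V j i * new_gen i = 0) ->
  (forall v, (forall i, bibound c.+1 d.+1 (v i)) -> \sum_i v i * new_gen i = 0 ->
    exists h : 'I_(size Gs) -> BP, (forall j, bibound (e1 j).+1 (e2 j).+1 (h j)) /\
    forall i, v i = \sum_j h j * V j i) ->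
  (forall j : 'I_(size Gs), Gs`_j = lift_vec (c1 j) (c2 j) (V j)) ->
  forall x, syz_part p c d x <-> Rspan_part Gs c d x.
Proof.
move=> ec ed Vb Vsyz Vgen eG x; split.
  move=> sx; split; last by case: sx.
  have [h [_ eh]] := syz_part_gens ec ed Vb Vgen sx.
  exists (fun j => hom (e1 j) (e2 j) (h j)) => l; rewrite eh.
  by apply: eq_bigr => j _; rewrite eG.
move=> [[h eh] bx]; split=> //; apply: (gens_comb_syz Vb Vsyz (h := h)) => l.
by rewrite eh; apply: eq_bigr => j _; rewrite eG.
Qed.

Lemma bihom_dim c d : has_dim (bihom (k := k) c d) (c.+1 * d.+1)%N.
Proof.
rewrite (_ : (_ * _)%N = #|{: 'I_c.+1 * 'I_d.+1}|); last by rewrite card_prod !card_ord.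
pose pol (f : 'I_c.+1 * 'I_d.+1 -> k) : BP := \poly_(i1 < c.+1) \poly_(i2 < d.+1) f (inord i1, inord i2).
have bpol f : bibound c.+1 d.+1 (pol f).
  split; first exact: size_poly.
  by move=> i; rewrite coef_poly; case: ifP => _; rewrite ?size_poly0 ?size_poly.
pose e (i : 'I_c.+1 * 'I_d.+1) : R := 'X_[mon c d i.1 i.2].
have sumE (f : 'I_c.+1 * 'I_d.+1 -> k) : \sum_i f i *: e i = hom c d (pol f).
  rewrite /hom pair_bigA /=.
  apply: eq_bigr => -[i1 i2] _ /=.
  by rewrite coef_poly ltn_ord coef_poly ltn_ord !inord_val.
apply: (@has_dim_fin _ _ _ _ e).
  move=> f; rewrite sumE => z [i1 i2].
  have := congr1 (fun F : BP => (F`_i1)`_i2) (homK (bpol f)).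
  by rewrite z rmorph0 !coef0 coef_poly ltn_ord coef_poly ltn_ord !inord_val.
move=> x; split; last by move=> [f ->]; rewrite sumE; apply: bihom_hom.
move=> bx; exists (fun i : 'I_c.+1 * 'I_d.+1 => ((dehom x)`_i.1)`_i.2); rewrite sumE -[LHS](dehomK bx); congr (hom _ _ _).
have [s t] := bibound_dehom bx.
apply/polyP=> i1; rewrite coef_poly; case: ltnP => [l1|g1]; last first.
  by rewrite nth_default // (leq_trans s).
apply/polyP=> i2; rewrite coef_poly; case: ltnP => [l2|g2]; last first.
  by rewrite nth_default // (leq_trans (t i1)).
by rewrite /= !inordK.
Qed.

End Transfer.

(** * The determinant of d_1 *)

Section MatrixOfD1.
Variable k : closedFieldType.
Local Notation R := {mpoly k[4]}.
Local Notation S := {mpoly k[4]}.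
Local Notation R4 := {ffun 'I_4 -> R}.
Variables (p : 'I_4 -> R) (c d : nat).

Lemma meval_tens (y : 'I_4 -> k) (f : S) (r : R) :
  (tens f r).@[fun i => (y i)%:MP] = f.@[y] *: r.
Proof.
rewrite /tens mevalM mevalC -mul_mpolyC; congr (_ * _).
move: f; apply: (@mpoly_rmorph_ext k 4 _ (meval (fun i => (y i)%:MP) \o map_mpoly (@mpolyC 4 k))
  (@mpolyC 4 k \o meval y)) => [x|i] /=.
  by rewrite map_mpolyC !mevalC.
by rewrite map_mpolyX !mevalXU.
Qed.

Lemma meval_d1 (y : 'I_4 -> k) (x : R4) :
  (d1 x).@[fun i => (y i)%:MP] = \sum_i y i *: x i.
Proof.
by rewrite /d1 rmorph_sum; apply: eq_bigr => i _; rewrite /= meval_tens mevalXU.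
Qed.

Lemma tensZ (f : S) (t : k) (r : R) : tens f (t *: r) = tens (t *: f) r.
Proof.
rewrite /tens map_mpolyZ -[t *: r]mul_mpolyC mpolyCM -[_ *: map_mpoly _ _]mul_mpolyC.
by rewrite mulrA; congr (_ * _); rewrite mulrC.
Qed.

Lemma tens_sumr (f : S) (I : finType) (r : I -> R) : tens f (\sum_i r i) = \sum_i tens f (r i).
Proof. by rewrite /tens rmorph_sum mulr_sumr. Qed.

Lemma tens_suml (I : finType) (f : I -> S) (r : R) : tens (\sum_i f i) r = \sum_i tens (f i) r.
Proof. by rewrite /tens rmorph_sum mulr_suml. Qed.

Lemma matrix_of_d1_exists m n : has_dim (syz_part p c d) n -> has_dim (bihom (k := k) c d) m ->
  exists M : 'M[S]_(m, n), is_matrix_of_d1 p c d M.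
Proof.
move=> [g bg] [h bh].
have gp j : syz_part p c d (g j).
  apply/(proj2 bg); exists (fun l => (l == j)%:R).
  rewrite (bigD1 j) //= eqxx scale1r [X in _ + X]big1 ?addr0 // => l /negPf ->.
  by rewrite scale0r.
have /fin_all_exists [x ex] : forall jl : 'I_n * 'I_4, exists x : 'I_m -> k,
    g jl.1 jl.2 = \sum_i x i *: h i.
  by move=> [j l]; apply/(proj2 bh); case: (gp j).
exists (\matrix_(i, j) \sum_l x (j, l) i *: 'X_l), g, h; split=> // j.
transitivity (\sum_l \sum_i tens (x (j, l) i *: 'X_l) (h i)).
  by apply: eq_bigr => l _; rewrite (ex (j, l)) tens_sumr; apply: eq_bigr => i _; rewrite tensZ.
by rewrite exchange_big; apply: eq_bigr => i _; rewrite mxE tens_suml.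
Qed.

Lemma matrix_of_d1_eval m n (M : 'M[S]_(m, n)) (y : 'I_4 -> k) (g : 'I_n -> R4) (h : 'I_m -> R) j :
  d1 (g j) = \sum_i tens (M i j) (h i) -> \sum_i y i *: g j i = \sum_i (M i j).@[y] *: h i.
Proof.
move=> e; rewrite -meval_d1 e rmorph_sum; apply: eq_bigr => i _.
by rewrite /= meval_tens.
Qed.

(** M evaluated at y represents the k-linear map that sends x to the sum of the y_i x_i; being
    square, it is invertible once this map is injective. *)
Lemma det_matrix_of_d1_neq0 n (M : 'M[S]_n) (y : 'I_4 -> k) : is_matrix_of_d1 p c d M ->
  (forall x, syz_part p c d x -> \sum_i y i *: x i = 0 -> x = 0) -> (\det M).@[y] != 0.
Proof.
move=> [g [h [[gfr gsp] _ eM]]] inj; rewrite -(det_map_mx (meval y)) -det_tr.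
apply/negP=> /det0P [v v0 vM]; case/eqP: v0; apply/rowP=> j; rewrite [RHS]mxE.
apply: (gfr (fun j => v 0 j)); apply: inj; first by apply/gsp; exists (fun j => v 0 j).
transitivity (\sum_j v 0 j *: \sum_i (M i j).@[y] *: h i).
  under [RHS]eq_bigr do rewrite -(matrix_of_d1_eval y (eM _)) scaler_sumr.
  rewrite exchange_big; apply: eq_bigr => i _; rewrite sum_ffunE scaler_sumr.
  by apply: eq_bigr => l _; rewrite ffunE !scalerA mulrC.
pose N := (map_mx (meval y) M)^T.
transitivity (\sum_j v 0 j *: \sum_i N j i *: h i).
  by apply: eq_bigr => l _; congr (_ *: _); apply: eq_bigr => i _; rewrite !mxE.
by rewrite comb_mulmx vM big1 // => i _; rewrite mxE scale0r.
Qed.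

(** d_1 is linear in the T_i, so M vanishes at the origin. This is what excludes the exponent 0
    later. *)
Lemma det_matrix_of_d1_at0 n (M : 'M[S]_n.+1) : is_matrix_of_d1 p c d M ->
  (\det M).@[fun=> 0] = 0.
Proof.
move=> [g [h [_ [hfr _] eM]]]; rewrite -(det_map_mx (meval (fun=> 0))).
rewrite (_ : map_mx _ M = 0) ?det0 //; apply/matrixP=> i j; rewrite !mxE.
apply: (hfr (fun i => (M i j).@[fun=> 0])); rewrite -(matrix_of_d1_eval _ (eM j)).
by rewrite big1 // => l _; rewrite scale0r.
Qed.

End MatrixOfD1.

(** * Injectivity of d_1 at points off the surface *)

Section OffSurface.
Variables (k : closedFieldType) (a b : nat) (p : 'I_4 -> {mpoly k[4]}).
Hypothesis a_gt0 : (0 < a)%N.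
Hypothesis b_gt0 : (0 < b)%N.
Hypothesis p_bideg : forall i, bihom a b (p i).
Hypothesis p_bpf : basepoint_free p.

Lemma sum_lift4 (V : nmodType) (i0 : 'I_4) (F : 'I_4 -> V) : \sum_i F i =
  F i0 + (F (lift i0 0) + F (lift i0 1) + F (lift i0 2%:R)).
Proof.
rewrite (bigD1_ord i0) //= !big_ord_recl big_ord0 addr0 !addrA.
by congr (_ + F (lift _ _) + F (lift _ _) + F (lift _ _)); apply: val_inj.
Qed.

Lemma d1_injective_off_surface (y : 'I_4 -> k) x : (exists i, y i != 0) -> ~ on_surface p y ->
  syz_part p (2 * a - 1) (b - 1) x -> \sum_i y i *: x i = 0 -> x = 0.
Proof.
move=> [i0 y0] off [sx bx] yx.
pose P i := dehom (p i); pose v i := dehom (x i); pose t i := (y i / y i0)%:P%:P : {poly {poly k}}.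
(* The equation y.x = 0 gives x_i0 as minus the sum of t_i x_i over the other indices. Substituting
   it turns the syzygy into a relation among the three f_i with i different from i0. *)
pose f i := P i - t i * P i0.
have bP i : bibound a.+1 b.+1 (P i) by apply: bibound_dehom.
have bt n f' : bibound n b.+1 f' -> forall i, bibound n b.+1 (t i * f').
  by move=> bf i; apply: (biboundCM (n' := 1)); rewrite ?size_polyC_leq1.
have bf i : bibound a.+1 b.+1 (f i) by apply/biboundB/bt.
have bv i : bibound a.*2 b (v i).
  have := bibound_dehom (bx i); rewrite subn1 prednK ?muln_gt0 // mul2n.
  by rewrite subn1 prednK.
have vP : \sum_i v i * P i = 0.
  by rewrite -[RHS](rmorph0 (@dehom k)) -sx rmorph_sum; apply: eq_bigr => i _; rewrite rmorphM.
have vy : v i0 = - (t (lift i0 0) * v (lift i0 0) + t (lift i0 1) * v (lift i0 1) +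
    t (lift i0 2%:R) * v (lift i0 2%:R)).
  apply/eqP; rewrite -addr_eq0; apply/eqP.
  transitivity (\sum_i t i * v i).
    by rewrite (sum_lift4 i0) (_ : t i0 = 1) ?mul1r // /t divff.
  transitivity (dehom ((y i0)^-1 *: \sum_i y i *: x i)); last by rewrite yx scaler0 rmorph0.
  rewrite scaler_sumr rmorph_sum; apply: eq_bigr => i _ /=.
  by rewrite scalerA dehomZ [_^-1 * _]mulrC.
(* At a common zero z the vector p(z) is proportional to y. It is nonzero by basepoint freeness, so
   y would lie on the surface. *)
have ncz : no_common_zero a b b b (f (lift i0 0)) (f (lift i0 1)) (f (lift i0 2%:R)).
  apply: no_common_zero_ev => z [z0 z1 z2]; apply: off.
  have ef i : ev a b z (f i) = (p i).@[pt_coord z] - y i / y i0 * (p i0).@[pt_coord z].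
    by rewrite /f evD evN evZ -!ev_dehom.
  have pz i : (p i).@[pt_coord z] = y i / y i0 * (p i0).@[pt_coord z].
    have [->|] := eqVneq i i0; first by rewrite divff // mul1r.
    rewrite eq_sym => /unlift_some -[j -> _]; apply: subr0_eq; rewrite -ef.
    case: j => -[|[|[|//]]] lt.
    - by rewrite (_ : Ordinal lt = 0) //; apply: val_inj.
    - by rewrite (_ : Ordinal lt = 1) //; apply: val_inj.
    - by rewrite (_ : Ordinal lt = 2%:R) //; apply: val_inj.
  exists (pt_coord z); split; first exact: pt_coord_point.
  have p0 : (p i0).@[pt_coord z] != 0.
    have [i] := p_bpf (pt_coord_point z); rewrite pz.
    by apply: contraNneq => ->; rewrite mulr0.
  exists (y i0 / (p i0).@[pt_coord z]); first by rewrite mulf_neq0 ?invr_eq0.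
  move=> i; rewrite (pz i); set B := _.@[_] in p0 *; set C := y i.
  by rewrite -mulrACA mulVf // mulr1 mulrC divfK.
(* D = 2b and the three u-degrees add up to 3b, so each l_i has size bound 0. *)
have [|||||||l0 [l1 [l2 [[E0 E1 E2]]]]] := koszul_exact (D := b + b) ncz (bf _) (bf _) (bf _)
   (c0 := v (lift i0 0)) (c1 := v (lift i0 1)) (c2 := v (lift i0 2%:R)).
- by case: (bv (lift i0 0)).
- by case: (bv (lift i0 1)).
- by case: (bv (lift i0 2%:R)).
- by move=> j; rewrite leq_add2r; case: (bv (lift i0 0)).
- by move=> j; rewrite leq_add2r; case: (bv (lift i0 1)).
- by move=> j; rewrite leq_add2r; case: (bv (lift i0 2%:R)).
- by rewrite -[RHS]vP (sum_lift4 i0) vy /f; ring.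
rewrite subnn => /bibound0_eq z0 /bibound0_eq z1 /bibound0_eq z2.
rewrite z0 z1 z2 !mulr0 subrr in E0 E1 E2.
have v0 i : v i = 0.
  have [->|] := eqVneq i i0; first by rewrite vy E0 E1 E2 !mulr0 !addr0 oppr0.
  rewrite eq_sym => /unlift_some -[j -> _]; case: j => -[|[|[|//]]] lt.
  - by rewrite -E0; congr (v (lift _ _)); apply: val_inj.
  - by rewrite -E1; congr (v (lift _ _)); apply: val_inj.
  - by rewrite -E2; congr (v (lift _ _)); apply: val_inj.
by apply/ffunP=> i; rewrite [RHS]ffunE; apply: (dehom_eq0 (bx i) (v0 i)).
Qed.

End OffSurface.

(** * Comparison of the determinant with the implicit equation *)

Section Determinant.
Variables (k : closedFieldType) (a b : nat) (p : 'I_4 -> {mpoly k[4]}).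
Hypothesis a_gt0 : (0 < a)%N.
Hypothesis b_gt0 : (0 < b)%N.
Hypothesis p_bideg : forall i, bihom a b (p i).
Hypothesis p_bpf : basepoint_free p.

(** [implicit_equation] describes the zeros of F only at nonzero vectors; this adds the origin,
    which Study's lemma also has to consider. *)
Lemma homog_nonunit_at0 n d (F : {mpoly k[n]}) : F \is d.-homog -> F != 0 ->
  F \isn't a GRing.unit -> F.@[fun=> 0] = 0.
Proof.
move=> hF F0 Fu; have d0 : (0 < d)%N.
  rewrite lt0n; apply: contraNneq Fu => d0.
  have e : F = (F@_0)%:MP.
    apply: msize1_polyC; rewrite mmeasureE; apply/bigmax_leqP_seq => m ms _.
    by rewrite (dhomog_mf hF ms) d0.
  by rewrite e mpolyC_unit; apply: contraNneq F0 => z; rewrite e z.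
rewrite mevalE big_seq big1 // => m /(dhomog_mf hF) md.
have [i mi] : exists i, m i != 0%N.
  apply: NNPP => h; suff m0 : m = 0%MM by move: md d0; rewrite m0 /= mdeg0 => <-.
  by apply/mnmP=> i; rewrite mnm0E; apply/eqP/negPn/negP=> mi; apply: h; exists i.
by rewrite (bigD1 i) //= expr0n (negPf mi) mul0r mulr0.
Qed.

Theorem det_d1_power (M : 'M[{mpoly k[4]}]_(2 * a * b)) F :
  is_matrix_of_d1 p (2 * a - 1) (b - 1) M -> implicit_equation p F ->
  exists (c : k) (e : nat), [/\ c != 0, (0 < e)%N & \det M = c *: F ^+ e].
Proof.
move=> hM [[F0 Fu Firr] [d Fh] FX].
have GF y : (\det M).@[y] = 0 -> F.@[y] = 0.
  move=> dM; have [/existsP y0|/existsPn y0] := boolP [exists i, y i != 0]; last first.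
    rewrite -(homog_nonunit_at0 Fh F0 Fu); apply: meval_eq => i.
    by have := y0 i; rewrite negbK => /eqP.
  apply/FX => //; apply: NNPP => off; have /eqP [] := det_matrix_of_d1_neq0 (y := y) hM
    (fun x => d1_injective_off_surface a_gt0 b_gt0 p_bideg p_bpf y0 off).
  exact: dM.
have G0 : \det M != 0.
  have [y Fy] := mpoly_nonroot F0; apply: contraNneq Fy => z.
  by rewrite GF // z meval0.
have [c [e [c0 eM]]] := irreducible_power Fu Firr G0 GF.
exists c, e; split=> //; rewrite lt0n; apply: contraNneq c0 => e0.
have n0 : (0 < 2 * a * b)%N by rewrite !muln_gt0 a_gt0.
move: M hM GF G0 eM n0; case: (2 * a * b)%N => // n M hM _ _ eM _.
by have := det_matrix_of_d1_at0 hM; rewrite eM e0 mevalZ expr0 meval1 mulr1 => ->.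
Qed.

End Determinant.

(** * Normal form of Q *)

Definition r0 : 'I_3 := @Ordinal 3 0 isT.
Definition r1 : 'I_3 := @Ordinal 3 1 isT.
Definition r2 : 'I_3 := @Ordinal 3 2 isT.

Lemma sum3 (V : nmodType) (F : 'I_3 -> V) : \sum_i F i = F r0 + F r1 + F r2.
Proof.
rewrite !big_ord_recl big_ord0 addr0 !addrA.
by congr (F _ + F _ + F _); apply: val_inj.
Qed.

Lemma forall3 (Pr : 'I_3 -> Prop) : Pr r0 -> Pr r1 -> Pr r2 -> forall i, Pr i.
Proof.
move=> h0 h1 h2 i; case: i => -[|[|[|m]]] lt //.
- by rewrite (_ : Ordinal lt = r0) //; apply: val_inj.
- by rewrite (_ : Ordinal lt = r1) //; apply: val_inj.
- by rewrite (_ : Ordinal lt = r2) //; apply: val_inj.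
Qed.

Section Structure.
Variables (k : closedFieldType) (a n : nat).
Local Notation R := {mpoly k[4]}.
Local Notation BP := {poly {poly k}}.
Local Notation R4 := {ffun 'I_4 -> R}.
Local Notation b := n.+3.
Variables (p : 'I_4 -> R) (Q : R4).
Hypothesis a_gt0 : (0 < a)%N.
Hypothesis p_bideg : forall i, bihom a b (p i).
Hypothesis p_free : kfree p.
Hypothesis p_bpf : basepoint_free p.
Hypothesis Q_syz : is_syzygy p 0 2 Q.
Hypothesis no_lin : no_linear_syzygy p.

Definition quad_coefs : 'M[k]_(3, 4) := \matrix_(j, l) (Q l)@_(quad_mon j).

Lemma dehom_quad_mon j : dehom ('X_[quad_mon j] : R) = ('X^(2 - j))%:P.
Proof. by move: j; apply: forall3; rewrite dehomX !mnmE /= mul1r. Qed.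

Lemma bihom_quad (x : R) : bihom 0 2 x -> x = \sum_j x@_(quad_mon j) *: 'X_[quad_mon j].
Proof.
move: x; apply: (@bihom_ind k 0 2 (fun x => x = \sum_j x@_(quad_mon j) *: 'X_[quad_mon j])).
- by rewrite big1 // => j _; rewrite mcoeff0 scale0r.
- move=> f g {1}-> {1}->; rewrite -big_split; apply: eq_bigr => j _.
  by rewrite mcoeffD scalerDl.
move=> x m e1 e2.
have [j em] : exists j, m = quad_mon j.
  have : (m vu <= 2)%N by lia.
  have mon_ext (m' : 'X_{1..4}) : m vs = m' vs -> m vt = m' vt -> m vu = m' vu -> m vv = m' vv -> m = m'.
    move=> E0 E1 E2 E3; apply/mnmP; apply: forall4.
    - by rewrite (_ : o0 = vs) //; apply: val_inj.
    - by rewrite (_ : o1 = vt) //; apply: val_inj.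
    - by rewrite (_ : o2 = vu) //; apply: val_inj.
    - by rewrite (_ : o3 = vv) //; apply: val_inj.
  case E : (m vu) => [|[|[|//]]] _; [exists r2 | exists r1 | exists r0];
    by apply: mon_ext; rewrite !mnmE /=; lia.
rewrite {m e1 e2}em (bigD1 j) //= mcoeffZ mcoeffX eqxx mulr1 big1 ?addr0 // => i ij.
rewrite mcoeffZ mcoeffX; case: eqP => [e|_]; last by rewrite mulr0 scale0r.
case/eqP: ij; apply: val_inj; have := congr1 (fun m : 'X_{1..4} => m vu) e.
by move: i j {e}; apply: forall3; apply: forall3; rewrite !mnmE.
Qed.

Definition quad_poly (C : 'M[k]_(3, 4)) i : {poly k} := \sum_(j < 3) C j i *: 'X^(2 - j).

Lemma size_quad_poly C i : (size (quad_poly C i) <= 3)%N.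
Proof.
apply: (big_ind (fun q : {poly k} => size q <= 3)%N); first by rewrite size_poly0.
  by move=> f g hf hg; apply: leq_trans (size_polyD _ _) _; rewrite geq_max hf hg.
by move=> j _; apply: leq_trans (size_scale_leq _ _) _; rewrite size_polyXn; lia.
Qed.

(** A change of generators by A multiplies the coefficient matrix of Q on the right by the inverse
    of A, so normal forms of Q come from rank factorizations of [quad_coefs], whose rank is dim
    V. *)
Lemma coords_quad A i : coords A Q i = (quad_poly (quad_coefs *m invmx A) i)%:P.
Proof.
have [_ [_ bQ]] := Q_syz.
transitivity (dehom (\sum_j (quad_coefs *m invmx A) j i *: ('X_[quad_mon j] : R))).
  congr dehom; under eq_bigr do rewrite (bihom_quad (bQ _)) scaler_sumr.
  rewrite exchange_big; apply: eq_bigr => j _ /=; rewrite mxE scaler_suml.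
  by apply: eq_bigr => l _; rewrite scalerA mxE mulrC.
rewrite /quad_poly !rmorph_sum; apply: eq_bigr => j _ /=.
by rewrite dehomZ dehom_quad_mon -polyCM mul_polyC.
Qed.

Lemma quad_rank r : has_dim (V_space p Q) r -> \rank quad_coefs = r.
Proof.
apply: (@has_dim_rank _ _ _ _ _ p) => // j; apply: eq_bigr => i _.
by rewrite mxE.
Qed.

Lemma lift_Q A : A \in unitmx -> Q = lift_vec A 0 2 (coords A Q).
Proof. by move=> Au; rewrite coordsK //; case: Q_syz => _ []. Qed.

Lemma lift_syzygy A c d v : A \in unitmx -> (forall i, bibound c.+1 d.+1 (v i)) ->
  \sum_i v i * new_gen p A i = 0 -> (exists i, v i != 0) -> is_syzygy p c d (lift_vec A c d v).
Proof.
move=> Au bv sv [i vi]; split.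
  apply: contraNneq vi => z; rewrite -(lift_vecK Au (bv i)) z /coords big1 ?rmorph0 //.
  by move=> l _; rewrite ffunE scaler0.
by split; [apply/(lift_vec_syz A p_bideg bv) | apply: bihom4_lift].
Qed.

Let c_eq : (2 * a - 1).+1 = a.*2.
Proof. by lia. Qed.

Let N := (2 * a * b)%N.

Theorem rank2_case : has_dim (V_space p Q) 2 ->
  (exists S1 S2 : R4, [/\ is_syzygy p a (b - 2) S1, is_syzygy p a (b - 2) S2
     & forall x, syz_part p (2 * a - 1) (b - 1) x <-> Rspan_part [:: Q; S1; S2] (2 * a - 1) (b - 1) x]) /\
  has_dim (syz_part p (2 * a - 1) (b - 1)) N.
Proof.
move=> /quad_rank rk; set A := row_ebase quad_coefs.
have Au : A \in unitmx := row_ebase_unit _.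
(* Taking A from the rank factorization leaves an invertible matrix times [pid_mx 2], whose last two
   columns vanish; hence Q becomes (q_0, q_1, 0, 0). *)
pose C := quad_coefs *m invmx A.
have EC : C = col_ebase quad_coefs *m pid_mx 2.
  by rewrite /C -[X in X *m invmx _]mulmx_ebase rk mulmxK.
have Q0 (i : 'I_4) : (2 <= i)%N -> coords A Q i = 0.
  move=> i2; rewrite coords_quad -/C /quad_poly big1 // => j _.
  rewrite EC mxE big1 ?scale0r // => l _; rewrite mxE.
  by case: eqP => [->|] /=; rewrite ?mulr0 // ltnNge i2 mulr0.
pose q0 := quad_poly C o0; pose q1 := quad_poly C o1.
have EQ i : coords A Q i = Q2 q0 q1 i.
  by move: i; apply: forall4; [exact: coords_quad | exact: coords_quad | exact: Q0 | exact: Q0].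
have [Qn0 [Qs bQ]] := Q_syz.
have QP : \sum_i coords A Q i * new_gen p A i = 0.
  by apply/(lift_vec_syz A p_bideg (fun i => coords_bound A i bQ)); rewrite -lift_Q.
have [||||||||S1 [S2 [[b1 s1 n1] [b2 s2 n2] gen free]]] :=
  @rank2_structure k a n (new_gen p A) q0 q1.
- by move=> i; apply: new_gen_bound.
- exact: new_gen_bpf.
- exact: size_quad_poly.
- exact: size_quad_poly.
- move=> [z0 z1]; case/eqP: Qn0; rewrite (lift_Q Au); apply/ffunP=> l; rewrite !ffunE.
  rewrite big1 // => i _; rewrite EQ (_ : Q2 q0 q1 i = 0) ?hom0 ?scaler0 //.
  by move: i; apply: forall4; rewrite /Q2 /vec4 /= ?z0 ?z1 ?polyC0.
- by rewrite -[RHS]QP sum4 !EQ /Q2 /vec4 /= !mul0r !addr0.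
- exact: new_gen_neq0.
(* A nonzero relation of this kind would lift to a syzygy of bidegree (0, 1). *)
- move=> x0 x1 sx0 sx1 e; pose v := vec4 x0%:P x1%:P 0 (0 : BP).
  have bv i : bibound 1 2 (v i).
    by move: i; apply: forall4; rewrite /v /vec4 /=; do ?[exact: biboundC | exact: bibound0].
  have v0 i : v i = 0.
    apply/eqP/negPn/negP=> vi; apply: (proj2 no_lin (lift_vec A 0 1 v)).
    apply: lift_syzygy => //; last by exists i.
    by rewrite sum4 /v /vec4 /= !mul0r !addr0.
  by split; apply/eqP; rewrite -polyC_eq0; apply/eqP; [apply: (v0 o0) | apply: (v0 o1)].
(* (c1, c2) are the bidegrees of Q, S1, S2, and (e1, e2) those of their multipliers in total
   bidegree (2a - 1, b - 1). *)
pose c1 (j : 'I_3) := nth 0%N [:: 0; a; a]%N j.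
pose c2 (j : 'I_3) := nth 0%N [:: 2; n.+1; n.+1]%N j.
pose e1 (j : 'I_3) := nth 0%N [:: 2 * a - 1; a - 1; a - 1]%N j.
pose e2 (j : 'I_3) := nth 0%N [:: n; 1; 1]%N j.
pose V (j : 'I_3) := nth (coords A Q) [:: coords A Q; S1; S2] j.
pose G1 := lift_vec A a n.+1 S1; pose G2 := lift_vec A a n.+1 S2.
have ec j : (e1 j + c1 j = 2 * a - 1)%N by move: j; apply: forall3; rewrite /e1 /c1 /=; lia.
have ed j : (e2 j + c2 j = b - 1)%N by move: j; apply: forall3; rewrite /e2 /c2 /=; lia.
have Vb j i : bibound (c1 j).+1 (c2 j).+1 (V j i).
  by move: j; apply: forall3 => //=; apply: coords_bound.
have Vs j : \sum_i V j i * new_gen p A i = 0 by move: j; apply: forall3.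
have Vgen v : (forall i, bibound (2 * a - 1).+1 (b - 1).+1 (v i)) -> \sum_i v i * new_gen p A i = 0 ->
    exists h : 'I_3 -> BP, (forall j, bibound (e1 j).+1 (e2 j).+1 (h j)) /\
    forall i, v i = \sum_j h j * V j i.
  rewrite c_eq subn1 /= => bv /(gen _ bv) [h [h1 [h2 [bh bh1 bh2 eh]]]].
  exists (fun j : 'I_3 => nth h [:: h; h1; h2] j); split.
    by apply: forall3; rewrite /e1 /e2 /= ?c_eq // subn1 prednK.
  by move=> i; rewrite eh sum3 /V /= EQ.
have Vfree (h : 'I_3 -> BP) : (forall j, bibound (e1 j).+1 (e2 j).+1 (h j)) ->
    (forall i, \sum_j h j * V j i = 0) -> forall j, h j = 0.
  move=> _ eh; have [|z0 z1 z2] := free (h r0) (h r1) (h r2); last exact: forall3.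
  by move=> i; rewrite -[RHS](eh i) sum3 /V /= EQ.
split.
  exists G1, G2; split.
  - by rewrite subn2; apply: lift_syzygy.
  - by rewrite subn2; apply: lift_syzygy.
  apply: (@gens_Rspan k a b p A p_bideg Au _ _ [:: Q; G1; G2] c1 c2 e1 e2 V ec ed Vb Vs Vgen).
  by apply: forall3 => //=; apply: lift_Q.
rewrite (_ : N = \sum_j (e1 j).+1 * (e2 j).+1)%N; last first.
  by rewrite sum3 /e1 /e2 /= /N; lia.
exact: (syz_part_dim p_bideg Au ec ed Vb Vs Vgen Vfree).
Qed.

Theorem rank3_case : has_dim (V_space p Q) 3 ->
  (exists S1 S2 S3 : R4, [/\ is_syzygy p a (b - 2) S1, is_syzygy p a (b - 1) S2, is_syzygy p a (b - 1) S3
     & forall x, syz_part p (2 * a - 1) (b - 1) x <-> Rspan_part [:: Q; S1; S2; S3] (2 * a - 1) (b - 1) x]) /\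
  has_dim (syz_part p (2 * a - 1) (b - 1)) N.
Proof.
move=> /quad_rank rk.
(* At full rank 3 the left factor of the rank factorization can be moved across [pid_mx 3] as a
   diagonal block and absorbed into A. The coefficient matrix becomes [pid_mx 3], that is, Q = (u^2,
   uv, v^2, 0). *)
pose A : 'M[k]_4 := block_mx (col_ebase quad_coefs) 0 0 1%:M *m row_ebase quad_coefs.
have Au : A \in unitmx.
  rewrite unitmx_mul row_ebase_unit andbT unitmxE.
  rewrite (@det_ublock _ 3 1) det1 mulr1 -unitmxE; exact: col_ebase_unit.
have EC : quad_coefs *m invmx A = pid_mx 3.
  have e (L : 'M[k]_3) : L *m (pid_mx 3 : 'M_(3, 3 + 1)) =
      (pid_mx 3 : 'M_(3, 3 + 1)) *m (block_mx L 0 0 1%:M : 'M_(3 + 1)).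
    rewrite pid_mx_row mul_mx_row mulmx1 mulmx0 mul_row_block.
    by rewrite mul1mx !mul0mx mulmx0 !addr0.
  apply: (canLR (mulmxK Au)); rewrite -[LHS]mulmx_ebase rk /A mulmxA; congr (_ *m _).
  exact: e.
have EQ i : coords A Q i = Q3 k i.
  rewrite coords_quad EC /quad_poly sum3 !mxE.
  move: i; apply: forall4; rewrite /Q3 /vec4 /= ?scale1r ?scale0r ?addr0 ?add0r ?polyC_exp ?expr0 //.
have [Qn0 [Qs bQ]] := Q_syz.
have QP : \sum_i coords A Q i * new_gen p A i = 0.
  by apply/(lift_vec_syz A p_bideg (fun i => coords_bound A i bQ)); rewrite -lift_Q.
have [|||||S1 [S2 [S3 [[b1 s1 n1] [b2 s2 n2] [b3 s3 n3] gen free]]]] :=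
  @rank3_structure k a n (new_gen p A).
- by move=> i; apply: new_gen_bound.
- exact: new_gen_bpf.
- by rewrite -[RHS]QP sum4 !EQ /Q3 /vec4 /= mul0r addr0 mul1r.
- exact: new_gen_neq0.
- exact: new_gen_neq0.
pose c1 (j : 'I_4) := nth 0%N [:: 0; a; a; a]%N j.
pose c2 (j : 'I_4) := nth 0%N [:: 2; n.+1; n.+2; n.+2]%N j.
pose e1 (j : 'I_4) := nth 0%N [:: 2 * a - 1; a - 1; a - 1; a - 1]%N j.
pose e2 (j : 'I_4) := nth 0%N [:: n; 1; 0; 0]%N j.
pose V (j : 'I_4) := nth (coords A Q) [:: coords A Q; S1; S2; S3] j.
pose G1 := lift_vec A a n.+1 S1; pose G2 := lift_vec A a n.+2 S2; pose G3 := lift_vec A a n.+2 S3.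
have ec j : (e1 j + c1 j = 2 * a - 1)%N by move: j; apply: forall4; rewrite /e1 /c1 /=; lia.
have ed j : (e2 j + c2 j = b - 1)%N by move: j; apply: forall4; rewrite /e2 /c2 /=; lia.
have Vb j i : bibound (c1 j).+1 (c2 j).+1 (V j i).
  by move: j; apply: forall4 => //=; apply: coords_bound.
have Vs j : \sum_i V j i * new_gen p A i = 0 by move: j; apply: forall4.
have Vgen v : (forall i, bibound (2 * a - 1).+1 (b - 1).+1 (v i)) -> \sum_i v i * new_gen p A i = 0 ->
    exists h : 'I_4 -> BP, (forall j, bibound (e1 j).+1 (e2 j).+1 (h j)) /\
    forall i, v i = \sum_j h j * V j i.
  rewrite c_eq subn1 /= => bv /(gen _ bv) [h [h1 [h2 [h3 [[bh bh1 bh2 bh3] eh]]]]].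
  exists (fun j : 'I_4 => nth h [:: h; h1; h2; h3] j); split.
    by apply: forall4; rewrite /e1 /e2 /= ?c_eq // subn1 prednK.
  by move=> i; rewrite eh sum4 /V /= EQ.
have Vfree (h : 'I_4 -> BP) : (forall j, bibound (e1 j).+1 (e2 j).+1 (h j)) ->
    (forall i, \sum_j h j * V j i = 0) -> forall j, h j = 0.
  move=> bh eh; have bh2 := bh o2; have bh3 := bh o3.
  rewrite /e1 /e2 /= subn1 prednK // in bh2 bh3.
  have [|z0 z1 z2 z3] := free (h o0) (h o1) (h o2) (h o3) bh2 bh3; last exact: forall4.
  by move=> i; rewrite -[RHS](eh i) sum4 /V /= EQ.
split.
  exists G1, G2, G3; split.
  - by rewrite subn2; apply: lift_syzygy.
  - by rewrite subn1; apply: lift_syzygy.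
  - by rewrite subn1; apply: lift_syzygy.
  apply: (@gens_Rspan k a b p A p_bideg Au _ _ [:: Q; G1; G2; G3] c1 c2 e1 e2 V ec ed Vb Vs Vgen).
  by apply: forall4 => //=; apply: lift_Q.
rewrite (_ : N = \sum_j (e1 j).+1 * (e2 j).+1)%N; last first.
  by rewrite sum4 /e1 /e2 /= /N; lia.
exact: (syz_part_dim p_bideg Au ec ed Vb Vs Vgen Vfree).
Qed.

End Structure.

Theorem mainTheorem1 (k : closedFieldType) (a b : nat)
  (p : 'I_4 -> {mpoly k[4]}) (Q : {ffun 'I_4 -> {mpoly k[4]}})
  (a_ge1 : (1 <= a)%N) (b_ge3 : (3 <= b)%N)
  (p_bideg : forall i, bihom a b (p i))
  (p_free : kfree p)
  (p_bpf : basepoint_free p)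
  (Q_min : is_min_syzygy p 0 2 Q)
  (no_lin : no_linear_syzygy p) :
  [/\ has_dim (V_space p Q) 2 ->
        exists S1 S2 : {ffun 'I_4 -> {mpoly k[4]}},
          [/\ is_syzygy p a (b - 2) S1,
              is_syzygy p a (b - 2) S2
            & forall x, syz_part p (2 * a - 1) (b - 1) x <->
                        Rspan_part [:: Q; S1; S2] (2 * a - 1) (b - 1) x],
      has_dim (V_space p Q) 3 ->
        exists S1 S2 S3 : {ffun 'I_4 -> {mpoly k[4]}},
          [/\ is_syzygy p a (b - 2) S1,
              is_syzygy p a (b - 1) S2,
              is_syzygy p a (b - 1) S3
            & forall x, syz_part p (2 * a - 1) (b - 1) x <->
                        Rspan_part [:: Q; S1; S2; S3] (2 * a - 1) (b - 1) x]
    & has_dim (V_space p Q) 2 \/ has_dim (V_space p Q) 3 ->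
        (exists M : 'M[{mpoly k[4]}]_(2 * a * b),
            is_matrix_of_d1 p (2 * a - 1) (b - 1) M) /\
        (forall (M : 'M[{mpoly k[4]}]_(2 * a * b)) (F : {mpoly k[4]}),
            is_matrix_of_d1 p (2 * a - 1) (b - 1) M ->
            implicit_equation p F ->
            exists (c : k) (e : nat),
              [/\ c != 0, (0 < e)%N & \det M = c *: F ^+ e])].
Proof.
have [Q_syz _] := Q_min.
move: b_ge3 p_bideg; case: b => [|[|[|n]]] // _ p_bideg.
have rank2 := rank2_case a_ge1 p_bideg p_free p_bpf Q_syz no_lin.
have rank3 := rank3_case a_ge1 p_bideg p_free p_bpf Q_syz.
split; [by case/rank2 | by case/rank3 |] => dimV.
have {dimV rank2 rank3} dim_syz : has_dim (syz_part p (2 * a - 1) (n.+3 - 1)) (2 * a * n.+3).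
  by case: dimV => [/rank2 [] | /rank3 []].
split; last by move=> M F; apply: det_d1_power.
apply: matrix_of_d1_exists => //.
have := bihom_dim k (2 * a - 1) (n.+3 - 1).
by rewrite !subn1 !prednK // muln_gt0.
Qed.
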